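(* There exist absolute constants $c>0$ and $n_0\in\mathbb{N}$ such that for every $n\geq n_0$ and all centered log-concave probability measures $\mu,\nu$ on $\mathbb{R}^n$ with densities satisfying $\|f_\mu\|_\infty=\|f_\nu\|_\infty$, $$\int_{\mathbb{R}^n}\varphi_{\mu}(x)\,d\nu(x)\leq \exp\left(-cn/L_{\mu}^2\right).$$
   Context: A log-concave probability measure on $\mathbb{R}^n$ is a Borel probability measure $\mu$ such that $\mu(\lambda A+(1-\lambda)B)\geq \mu(A)^{\lambda}\mu(B)^{1-\lambda}$ for all compact $A,B$ and $\lambda\in(0,1)$, and $\mu(H)<1$ for every hyperplane $H$; it has a log-concave density $f_\mu$. Centered means barycenter at the origin. $\varphi_\mu(x)=\inf\{\mu(H): H$ a half-space containing $x\}$ (Tukey's half-space depth). $L_\mu=\|f_\mu\|_\infty^{1/n}[\det\mathrm{Cov}(\mu)]^{1/(2n)}$. *)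

(* Defs.v *)
From HB Require Import structures.
From mathcomp Require Import all_boot all_order all_algebra.
From mathcomp Require Import all_classical all_reals all_analysis.
Set Implicit Arguments. Unset Strict Implicit. Unset Printing Implicit Defensive.
Import Order.TTheory GRing.Theory Num.Theory.
Local Open Scope classical_set_scope.
Local Open Scope ring_scope.

Section LogConcave.
Variable R : realType.

(* Lebesgue integral on R^n = 'rV[R]_n, written as an iterated integral
   over the coordinates (Fubini/Tonelli); R^0 is a single point. *)
Fixpoint iint (n : nat) : ('rV[R]_n -> \bar R) -> \bar R :=
  match n return ('rV[R]_n -> \bar R) -> \bar R with
  | 0 => fun F => F 0
  | m.+1 => fun F =>
      (\int[@lebesgue_measure R]_(t in setT)
          iint (fun y : 'rV[R]_m => F (row_mx (const_mx t : 'rV[R]_1) y)))%E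
  end.

Definition dotv (n : nat) (u v : 'rV[R]_n) : R := \sum_(i < n) u 0 i * v 0 i.

Definition halfspace (n : nat) (H : set 'rV[R]_n) : Prop :=
  exists (theta : 'rV[R]_n) (t : R), theta != 0 /\ H = [set y | t <= dotv theta y].

Definition log_concave_fun (n : nat) (f : 'rV[R]_n -> R) : Prop :=
  (forall x, 0 <= f x) /\
  forall (x y : 'rV[R]_n) (l : R), 0 < l < 1 ->
    f x `^ l * f y `^ (1 - l) <= f (l *: x + (1 - l) *: y).

Definition dmeasure (n : nat) (f : 'rV[R]_n -> R) (A : set 'rV[R]_n) : \bar R :=
  iint (fun y => (\1_A y * f y)%:E).

Definition log_concave_density (n : nat) (f : 'rV[R]_n -> R) : Prop :=
  log_concave_fun f /\ iint (fun y => (f y)%:E) = 1%E.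

Definition barycenter (n : nat) (f : 'rV[R]_n -> R) (i : 'I_n) : R :=
  fine (iint (fun x => (x 0 i * f x)%:E)).

Definition centered (n : nat) (f : 'rV[R]_n -> R) : Prop :=
  forall i, barycenter f i = 0.

Definition covariance (n : nat) (f : 'rV[R]_n -> R) : 'M[R]_n :=
  \matrix_(i, j) (fine (iint (fun x => (x 0 i * x 0 j * f x)%:E))
                  - barycenter f i * barycenter f j).

(* ||f||_oo (for log-concave f, sup = ess sup) *)
Definition supnorm (n : nat) (f : 'rV[R]_n -> R) : \bar R :=
  ereal_sup (range (fun x => (f x)%:E)).

Definition tukey_depth (n : nat) (f : 'rV[R]_n -> R) (x : 'rV[R]_n) : \bar R :=
  ereal_inf [set dmeasure f H | H in [set H | halfspace H /\ H x]].

Definition isotropic_const (n : nat) (f : 'rV[R]_n -> R) : R :=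
  fine (supnorm f) `^ (n%:R^-1) * (\det (covariance f)) `^ ((2 * n)%:R^-1).

End LogConcave.

(* Main.v *)
Require Import Defs.
From HB Require Import structures.
From mathcomp Require Import all_boot all_order all_algebra.
From mathcomp Require Import all_classical all_reals all_analysis.
From mathcomp Require Import measurable_realfun.
From mathcomp Require Import ring lra.

(* Let X_1, ..., X_m be independent with density f = f_mu, G an independent
   centered Gaussian vector with covariance m Cov(mu), and p the density of
   X_1 + ... + X_m + G, which is log-concave by Prekopa-Leindler. If a half-space
   through w has measure at least h for mu, then X_1 + ... + X_m lies in its
   m-fold dilation with probability at least h^m; choosing the half-space that
   separates m w / 2 from {p > p(m w / 2)}, log-concavity gives
     phi_mu(w)^m <= 2^(n+1) p(m w / 2) / p(0),
   whereas p(0) >= c^n m^(-n/2) det Cov(mu)^(-1/2) by Jensen's inequality.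
   Integrating in w,
     ||f||_oo * int phi_mu^m <= (C L_mu / sqrt m)^n.
   For m of order L_mu^2 the right-hand side is at most e^(-n), and
   int phi_mu dnu <= e^(-n/m) follows from the power mean inequality, since the
   density of nu is bounded by ||f||_oo. Convolving m copies plays the role
   of the affine isoperimetric inequality for centroid bodies. *)

Set Implicit Arguments.
Unset Strict Implicit.
Unset Printing Implicit Defensive.
Import Order.TTheory GRing.Theory Num.Theory.
Import numFieldNormedType.Exports HBNNSimple.
Local Open Scope classical_set_scope.
Local Open Scope ring_scope.

(** The densities are arbitrary log-concave functions, with no measurability assumed, and the depth
    stands under the integral sign without being shown measurable. Each density is therefore
    replaced by a Borel version. The integral of a nonnegative function is a supremum over simple
    functions, hence monotone for all functions, and the depth is only ever bounded pointwise from
    above before anything is integrated. For the same reason the power mean inequality takes the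
    form of a tangent-line bound of the depth by its m-th power. The Gaussian summand makes the
    density of the sum finite and positive everywhere; its symmetry gives mass at least 1/2 to a
    half-space bounded by a hyperplane through the origin, and its quadratic exponent turns Jensen's
    inequality into a second-moment computation. Its covariance [m Cov(mu)] matches that of the sum,
    so that Jensen costs a factor [e^(-n/2)] whatever m is. Since [L_mu] is bounded below by an
    absolute constant, rounding m up to an integer changes it by a bounded factor only. *)

Lemma le_integralT d (T : measurableType d) (R : realType)
    (mu : {measure set T -> \bar R}) (f g : T -> \bar R) :
  (forall x, 0 <= f x)%E -> (forall x, f x <= g x)%E ->
  (\int[mu]_x f x <= \int[mu]_x g x)%E.
Proof.
move=> f0 fg.
have g0 x : (0 <= g x)%E by apply: le_trans (fg x).
rewrite !ge0_integralTE//.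
apply: ereal_sup_le => _ [h hf <-]; exists h => // x.
exact: le_trans (hf x) (fg x).
Qed.

(** A simple function below [f] keeps its integral when multiplied by the indicator of the
    complement of [N], and is then below [g]. So [f] and [g] can be arbitrary. *)
Lemma integralE_off d (T : measurableType d) (R : realType)
    (mu : {measure set T -> \bar R}) (N : set T) (f g : T -> \bar R) :
  measurable N -> mu N = 0%E -> (forall x, ~ N x -> f x = g x) ->
  (\int[mu]_x f x = \int[mu]_x g x)%E.
Proof.
move=> mN N0.
have le_off (u v : T -> \bar R) : (forall x, 0 <= u x)%E ->
    (forall x, 0 <= v x)%E -> (forall x, ~ N x -> u x = v x) ->
    (\int[mu]_x u x <= \int[mu]_x v x)%E.
  move=> u0 v0 uv; rewrite {1}ge0_integralTE//.
  apply: ge_ereal_sup => _ [h /= hu <-].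
  rewrite -integralT_nnsfun.
  have mNC : measurable (~` N) by exact: measurableC.
  have -> : (\int[mu]_x (h x)%:E = \int[mu]_x ((h x * \1_(~` N) x)%:E))%E.
    apply: ge0_ae_eq_integral => //.
    - exact/measurable_EFinP/measurable_funP.
    - apply/measurable_EFinP/measurable_funM; first exact/measurable_funP.
      exact: measurable_indic.
    - by move=> x _; rewrite lee_fin.
    - by move=> x _; rewrite lee_fin mulr_ge0.
    exists N; split=> // x /= nx; apply: contrapT => Nx; apply: nx => _.
    by rewrite indicE mem_set ?mulr1.
  apply: le_integralT => x; first by rewrite lee_fin mulr_ge0.
  rewrite indicE; case: (boolP (x \in ~` N)) => Nx; last by rewrite mulr0.
  by rewrite mulr1 -uv//; exact: set_mem Nx.
have eq_off (u v : T -> \bar R) : (forall x, 0 <= u x)%E ->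
    (forall x, 0 <= v x)%E -> (forall x, ~ N x -> u x = v x) ->
    (\int[mu]_x u x = \int[mu]_x v x)%E.
  move=> u0 v0 uv; apply/eqP; rewrite eq_le !le_off//.
  by move=> x /uv.
move=> fg; rewrite integralE [RHS]integralE; congr (_ - _)%E.
- by apply: eq_off => // x /fg fgx; rewrite !funeposE fgx.
- by apply: eq_off => // x /fg fgx; rewrite !funenegE fgx.
Qed.

(** * Changes of variables on the line and products of sigma-finite measures *)

Lemma affine_measurable (R : realType) (c b : R) :
  measurable_fun setT
    ((fun x => c * x + b) : measurableTypeR R -> measurableTypeR R).
Proof. by apply: measurable_funD => //; exact: measurable_funM. Qed.

Definition affine_push (R : realType) (c b : R) :
    {measure set (measurableTypeR R) -> \bar R} :=
  let m : {measure set (measurableTypeR R) -> \bar R} := lebesgue_measure in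
  ltac:(unshelve refine
    (pushforward m ((fun x => c * x + b) : measurableTypeR R -> measurableTypeR R)
      : {measure set (measurableTypeR R) -> \bar R}); exact: affine_measurable).

Lemma affine_pushE (R : realType) (c b : R) : 0 < c ->
  forall A, measurable A ->
  lebesgue_measure A = mscale `|c|%:nng (affine_push c b) A.
Proof.
move=> c0 A mA.
rewrite (@lebesgue_measure_unique R (mscale `|c|%:nng (affine_push c b)))//.
move=> X [[x y] _ <-] /=.
rewrite /mscale /= /pushforward gtr0_norm//.
have -> : (fun x => c * x + b) @^-1` `]x, y] =
    `](x - b) / c, (y - b) / c]%classic.
  apply/seteqP; split => z /=; rewrite !in_itv/= ltr_pdivrMr// ler_pdivlMr//;
    by rewrite ltrBlDr lerBrDr mulrC.
rewrite !lebesgue_measure_itv /= !lte_fin.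
rewrite ltr_pM2r ?invr_gt0// ltrD2r; case: ifPn => _; last by rewrite mule0.
by rewrite -!EFinB -EFinM; congr (_%:E); field; rewrite gt_eqF.
Qed.

Lemma integral_affine (R : realType) (c b : R) (f : R -> \bar R) : 0 < c ->
  measurable_fun setT f -> (forall x, 0 <= f x)%E ->
  (\int[lebesgue_measure]_x f x =
   c%:E * \int[lebesgue_measure]_x f (c * x + b)%R)%E.
Proof.
move=> c0 mf f0.
rewrite (@eq_measure_integral _ _ _ _ (mscale `|c|%:nng (affine_push c b))).
  rewrite ge0_integral_mscale//= gtr0_norm//; congr (_ * _)%E.
  by rewrite ge0_integral_pushforward//; exact: affine_measurable.
by move=> A mA _; exact: affine_pushE.
Qed.

Lemma integral_opp (R : realType) (f : R -> \bar R) :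
  measurable_fun setT f -> (forall x, 0 <= f x)%E ->
  (\int[lebesgue_measure]_x f x = \int[lebesgue_measure]_x f (- x)%R)%E.
Proof.
move=> mf f0.
rewrite (@eq_measure_integral _ _ _ _ (pushforward lebesgue_measure (-%R : _ -> measurableTypeR R))); last first.
  by move=> A mA _; exact/esym/lebesgue_measureN.
by rewrite ge0_integral_pushforward.
Qed.

Lemma sigma_finite_prod d1 d2 (T1 : measurableType d1) (T2 : measurableType d2)
    (R : realType) (m1 : {sigma_finite_measure set T1 -> \bar R})
    (m2 : {sigma_finite_measure set T2 -> \bar R}) :
  sigma_finite setT (m1 \x m2)%E.
Proof.
have /sigma_finiteP[/= F [UF ndF mF]] := @sigma_finiteT _ _ _ m1.
have /sigma_finiteP[/= G [UG ndG mG]] := @sigma_finiteT _ _ _ m2.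
exists (fun i => F i `*` G i).
  apply/esym; rewrite -subTset => -[x y] _.
  have [i _ Fi] : (\bigcup_i F i) x by rewrite -UF.
  have [j _ Gj] : (\bigcup_i G i) y by rewrite -UG.
  exists (maxn i j) => //; split => /=.
    by move: Fi; apply/subsetPset/ndF/leq_maxl.
  by move: Gj; apply/subsetPset/ndG/leq_maxr.
move=> i; have [mFi Fi] := mF i; have [mGi Gi] := mG i.
split; first exact: measurableX.
rewrite product_measure1E//.
by apply: lte_mul_pinfty => //; rewrite ge0_fin_numE.
Qed.

(** * Measurability on ['rV_n] and iterated integrals as single integrals *)

Definition measurable_row (R : realType) n d (T : measurableType d) (c : T -> 'rV[R]_n) :=
  forall i, measurable_fun setT (fun t => c t 0 i).

(* Borel measurability on ['rV_n], tested on all measurable maps into it: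
   this is stable under composition by construction. *)
Definition borel_fun (R : realType) n (F : 'rV[R]_n -> \bar R) :=
  forall d (T : measurableType d) (c : T -> 'rV[R]_n),
    measurable_row c -> measurable_fun setT (F \o c).

Lemma measurable_row_mx (R : realType) n d (T : measurableType d)
    (s : T -> R) (c : T -> 'rV[R]_n) :
  measurable_fun setT s -> measurable_row c ->
  measurable_row (fun t => row_mx (const_mx (s t) : 'rV_1) (c t)).
Proof.
move=> ms mc i; rewrite /row_mx.
under eq_fun do rewrite mxE.
case: (fintype.split i) => j; last exact: mc.
by under eq_fun do rewrite mxE.
Qed.

Lemma borel_slice (R : realType) n (F : 'rV[R]_n.+1 -> \bar R) t :
  borel_fun F -> borel_fun (fun y : 'rV[R]_n => F (row_mx (const_mx t : 'rV_1) y)).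
Proof.
move=> mF d T c mc.
apply: (mF _ _ (fun t' => row_mx (const_mx t : 'rV_1) (c t') : 'rV_n.+1)).
exact: measurable_row_mx.
Qed.

(** Gives access to the theory of a single measure: [T] is an iterated product and [rv] reads off
    its coordinates, so ['rV_n] itself carries no measurable structure. The integrable case serves
    the signed integrands of barycenter and covariance. *)
Lemma iint_rep (R : realType) n :
  exists d (T : measurableType d) (mu : {sigma_finite_measure set T -> \bar R})
    (rv : T -> 'rV[R]_n), measurable_row rv /\
    (forall F, borel_fun F -> (forall x, 0 <= F x)%E ->
       iint F = (\int[mu]_w F (rv w))%E) /\
    (forall F, borel_fun F -> mu.-integrable setT (F \o rv) ->
       iint F = (\int[mu]_w F (rv w))%E).
Proof.
elim: n => [|n [d [T [mu [rv [mrv [IH0 IH1]]]]]]].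
  exists _, unit, (@dirac _ unit tt R), (fun=> 0); split; first by move=> [].
  by split => F mF _ /=; rewrite integral_dirac//= ?diracT ?mul1e.
pose M := Measure_isSigmaFinite.Build _ _ _ (@lebesgue_measure R \x mu)%E
  (sigma_finite_prod _ _).
pose nu : {sigma_finite_measure set (measurableTypeR R * T)%type -> \bar R} :=
  HB.pack (@lebesgue_measure R \x mu)%E M.
exists _, (measurableTypeR R * T)%type, nu.
exists (fun w => row_mx (const_mx w.1 : 'rV_1) (rv w.2)).
have mrv' : measurable_row (fun w : measurableTypeR R * T => row_mx (const_mx w.1 : 'rV_1) (rv w.2)).
  apply: measurable_row_mx => // i.
  exact: (measurableT_comp (mrv i)).
split => //; split => F mF.
  move=> F0.
  transitivity (\int[lebesgue_measure \x mu]_w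
      F (row_mx (const_mx w.1 : 'rV_1) (rv w.2) : 'rV_n.+1))%E => //.
  rewrite fubini_tonelli1//=.
    by apply: eq_integral => t _; rewrite IH0//; exact: borel_slice.
  exact: mF mrv'.
move=> iF.
transitivity (\int[lebesgue_measure \x mu]_w
      F (row_mx (const_mx w.1 : 'rV_1) (rv w.2) : 'rV_n.+1))%E => //.
rewrite -(integral12_prod_meas1 iF)/= /fubini_F/=.
have [N [mN N0 NP]] := ae_integrable1 iF.
(* Only almost every slice is integrable, and on the other slices the induction hypothesis is
   silent. *)
apply: (integralE_off mN N0) => t Nt; apply: IH1; first exact: borel_slice.
by apply: contrapT => h; apply: Nt; apply: NP.
Qed.

(** * Iterated integrals of Borel functions *)

Section iint_theory.
Variable R : realType.
Local Open Scope ereal_scope.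

Lemma iint_ge0 n (F : 'rV[R]_n -> \bar R) : (forall x, 0 <= F x) -> 0 <= iint F.
Proof.
elim: n F => [|n IH] F F0 //=.
by apply: integral_ge0 => t _; exact: IH.
Qed.

Lemma le_iint n (F G : 'rV[R]_n -> \bar R) :
  (forall x, 0 <= F x) -> (forall x, F x <= G x) -> iint F <= iint G.
Proof.
elim: n F G => [|n IH] F G F0 FG //=.
apply: le_integralT => t; first exact: iint_ge0.
exact: IH.
Qed.

Lemma eq_iint n (F G : 'rV[R]_n -> \bar R) : F =1 G -> iint F = iint G.
Proof. by move=> /funext ->. Qed.

(** Joint measurability in a parameter and a point, again tested on measurable maps, so that
    sections and substitutions are mere compositions. *)
Definition borel_param d (T : measurableType d) n (G : T -> 'rV[R]_n -> \bar R) :=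
  forall d' (T' : measurableType d') (u : T' -> T) (c : T' -> 'rV[R]_n),
    measurable_fun setT u -> measurable_row c -> measurable_fun setT (fun t => G (u t) (c t)).

Definition borel_fun2 k n (G : 'rV[R]_k -> 'rV[R]_n -> \bar R) :=
  forall d' (T' : measurableType d') (u : T' -> 'rV[R]_k) (c : T' -> 'rV[R]_n),
    measurable_row u -> measurable_row c -> measurable_fun setT (fun t => G (u t) (c t)).

Lemma measurable_row_cst d (T : measurableType d) n (a : 'rV[R]_n) : measurable_row (fun _ : T => a).
Proof. by move=> i; exact: measurable_cst. Qed.

Lemma measurable_row_comp d (T : measurableType d) d' (T' : measurableType d') n
    (c : T -> 'rV[R]_n) (u : T' -> T) :
  measurable_fun setT u -> measurable_row c -> measurable_row (c \o u).
Proof. by move=> mu mc i; exact: (measurableT_comp (mc i) mu). Qed.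

Lemma measurable_rowD d (T : measurableType d) n (c c' : T -> 'rV[R]_n) :
  measurable_row c -> measurable_row c' -> measurable_row (fun t => c t + c' t)%R.
Proof.
by move=> mc mc' i; under eq_fun do rewrite mxE; exact: measurable_funD.
Qed.

Lemma measurable_rowZ d (T : measurableType d) n a (c : T -> 'rV[R]_n) :
  measurable_row c -> measurable_row (fun t => a *: c t)%R.
Proof.
by move=> mc i; under eq_fun do rewrite mxE; exact: measurable_funM.
Qed.

Lemma measurable_rowB d (T : measurableType d) n (c c' : T -> 'rV[R]_n) :
  measurable_row c -> measurable_row c' -> measurable_row (fun t => c t - c' t)%R.
Proof.
move=> mc mc' i; under eq_fun do rewrite 2!mxE.
exact: measurable_funB.
Qed.

Lemma borel_fun2_section k n (G : 'rV[R]_k -> 'rV[R]_n -> \bar R) z : borel_fun2 G -> borel_fun (G z).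
Proof. by move=> mG d T c mc; apply: (mG _ _ (fun=> z) c) => //; exact: measurable_row_cst. Qed.

Lemma borel_param_section d (T : measurableType d) n (G : T -> 'rV[R]_n -> \bar R) z :
  borel_param G -> borel_fun (G z).
Proof. by move=> mG d' T' c mc; apply: (mG _ _ (fun=> z) c). Qed.

Lemma borel_fun2_swap k n (G : 'rV[R]_k -> 'rV[R]_n -> \bar R) :
  borel_fun2 G -> borel_fun2 (fun x z => G z x).
Proof. by move=> mG d T u c mu mc; exact: mG. Qed.

Lemma borel_fun2_param k n d (T : measurableType d) (u : T -> 'rV[R]_k)
    (G : 'rV[R]_k -> 'rV[R]_n -> \bar R) :
  measurable_row u -> borel_fun2 G -> borel_param (fun t => G (u t)).
Proof.
by move=> mu mG d' T' v c mv mc; apply: (mG _ _ (u \o v)) => //; exact: measurable_row_comp.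
Qed.

Lemma measurable_iint d (T : measurableType d) n (G : T -> 'rV[R]_n -> \bar R) :
  borel_param G -> (forall t x, 0 <= G t x) -> measurable_fun setT (fun t => iint (G t)).
Proof.
move=> mG G0; have [d' [T' [mu [rv [mrv [rvE _]]]]]] := iint_rep R n.
rewrite (_ : (fun t => _) = fun t => \int[mu]_w G t (rv w)); last first.
  by apply/funext => t; apply: rvE => //; exact: borel_param_section.
apply: (@measurable_fun_fubini_tonelli_F _ _ _ _ _ mu
  (fun tw : T * T' => G tw.1 (rv tw.2))) => //.
by apply: (mG _ _ fst (rv \o snd)) => //; exact: measurable_row_comp.
Qed.

Lemma borel_iint k n (G : 'rV[R]_k -> 'rV[R]_n -> \bar R) :
  borel_fun2 G -> (forall t x, 0 <= G t x) -> borel_fun (fun z => iint (G z)).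
Proof.
move=> mG G0 d T c mc.
by apply: (measurable_iint (G := fun t => G (c t))) => //; exact: borel_fun2_param.
Qed.

Lemma iint_swap k n (G : 'rV[R]_k -> 'rV[R]_n -> \bar R) :
  borel_fun2 G -> (forall t x, 0 <= G t x) ->
  iint (fun z => iint (G z)) = iint (fun x => iint (fun z => G z x)).
Proof.
move=> mG G0.
have [d [T [mu [rv [mrv [rvE _]]]]]] := iint_rep R k.
have [d' [T' [mu' [rv' [mrv' [rvE' _]]]]]] := iint_rep R n.
rewrite rvE; [|exact: borel_iint|by move=> z; exact: iint_ge0].
rewrite rvE'; [|apply: borel_iint => //; exact: borel_fun2_swap|by move=> z; exact: iint_ge0].
transitivity (\int[mu]_w \int[mu']_w' G (rv w) (rv' w')).
  by apply: eq_integral => w _; apply: rvE' => //; exact: borel_fun2_section.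
rewrite (fubini_tonelli (fun ww => G (rv ww.1) (rv' ww.2) : \bar R))//; last first.
  by apply: (mG _ (T * T')%type (rv \o fst) (rv' \o snd)); exact: measurable_row_comp.
apply: eq_integral => w _; apply/esym/rvE => //.
exact: (borel_fun2_section (G := fun x z => G z x) _ (borel_fun2_swap mG)).
Qed.

Lemma iint_integral_swap n (G : R -> 'rV[R]_n -> \bar R) :
  borel_param (G : measurableTypeR R -> _) -> (forall t x, 0 <= G t x) ->
  \int[lebesgue_measure]_t iint (G t) =
  iint (fun x => \int[lebesgue_measure]_t G t x).
Proof.
move=> mG G0.
have [d' [T' [mu' [rv' [mrv' [rvE' _]]]]]] := iint_rep R n.
rewrite rvE'; last by move=> x; exact: integral_ge0.
  transitivity (\int[lebesgue_measure]_w \int[mu']_w' G w (rv' w')).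
    by apply: eq_integral => w _; apply: rvE' => //; exact: borel_param_section mG.
  rewrite (fubini_tonelli (fun ww : measurableTypeR R * _ => G ww.1 (rv' ww.2)))//.
  by apply: (mG _ _ fst (rv' \o snd)) => //; exact: measurable_row_comp.
move=> d T c mc.
apply: (@measurable_fun_fubini_tonelli_F _ _ _ _ _ (@lebesgue_measure R)
  (fun tw : T * measurableTypeR R => G tw.2 (c tw.1))) => //.
by apply: (mG _ _ snd (c \o fst)) => //; exact: measurable_row_comp.
Qed.

Lemma borel_param_slice n (F : 'rV[R]_n.+1 -> \bar R) : borel_fun F ->
  borel_param (fun (t : measurableTypeR R) (y : 'rV[R]_n) => F (row_mx (const_mx t : 'rV_1) y)).
Proof.
move=> mF d T u c mu mc.
apply: (mF _ _ (fun t' => row_mx (const_mx (u t') : 'rV_1) (c t') : 'rV_n.+1)).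
exact: measurable_row_mx.
Qed.

Lemma measurable_slice n (F : 'rV[R]_n.+1 -> \bar R) : borel_fun F ->
  (forall x, 0 <= F x) ->
  measurable_fun setT (fun t : measurableTypeR R =>
    iint (fun y : 'rV[R]_n => F (row_mx (const_mx t : 'rV_1) y))).
Proof. by move=> mF F0; apply: measurable_iint => //; exact: borel_param_slice. Qed.

Lemma iintD n (F G : 'rV[R]_n -> \bar R) : borel_fun F -> borel_fun G ->
  (forall x, 0 <= F x) -> (forall x, 0 <= G x) ->
  iint (fun x => F x + G x) = iint F + iint G.
Proof.
move=> mF mG F0 G0; have [d [T [mu [rv [mrv [rvE _]]]]]] := iint_rep R n.
rewrite !rvE//; first by apply: ge0_integralD => //; [exact: mF|exact: mG].
- by move=> d' T' c mc; apply: emeasurable_funD; [exact: mF|exact: mG].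
- by move=> x; exact: adde_ge0.
Qed.

Lemma borel_funZ n (F : 'rV[R]_n -> \bar R) (k : R) : borel_fun F -> borel_fun (fun x => k%:E * F x).
Proof. by move=> mF d' T' c mc; apply: measurable_funeM; exact: mF mc. Qed.

Lemma iintZ n (F : 'rV[R]_n -> \bar R) (k : R) : borel_fun F -> (0 <= k)%R ->
  (forall x, 0 <= F x) -> iint (fun x => k%:E * F x) = k%:E * iint F.
Proof.
move=> mF k0 F0; have [d [T [mu [rv [mrv [rvE _]]]]]] := iint_rep R n.
rewrite !rvE//; first by apply: ge0_integralZl_EFin => //; exact: mF.
- exact: borel_funZ.
- by move=> x; rewrite mule_ge0// lee_fin.
Qed.

Lemma iint_affine n (F : 'rV[R]_n -> \bar R) (c : R) (a : 'rV[R]_n) :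
  borel_fun F -> (forall x, 0 <= F x) -> (0 < c)%R ->
  iint F = (c ^+ n)%:E * iint (fun x => F (c *: x + a)%R).
Proof.
elim: n F a => [|n IH] F a mF F0 c0.
  by rewrite /= expr0 mul1e; congr F; apply/rowP => -[].
have aE : a = row_mx (const_mx (a ord0 ord0) : 'rV_1) (rsubmx (a : 'rV_(1 + n))).
  have <- : lsubmx (a : 'rV_(1 + n)) = const_mx (a ord0 ord0); last by rewrite hsubmxK.
  by apply/rowP => i; rewrite !mxE; congr (a _ _); apply/val_inj; rewrite /= !ord1.
rewrite /=.
transitivity (\int[lebesgue_measure]_(t in setT) ((c ^+ n)%:E *
    iint (fun y : 'rV_n => F (row_mx (const_mx t : 'rV_1)
       (c *: y + rsubmx (a : 'rV_(1 + n)))%R)))).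
  apply: eq_integral => t _; apply: (IH (fun y : 'rV_n => F (row_mx (const_mx t : 'rV_1) y : 'rV_n.+1))) => //.
  exact: borel_slice.
have m1 : measurable_fun setT (fun t : measurableTypeR R =>
    iint (fun y : 'rV_n => F (row_mx (const_mx t : 'rV_1)
       (c *: y + rsubmx (a : 'rV_(1 + n)))%R))).
  apply: measurable_iint => // d T u v mu mv.
  apply: (mF _ _ (fun t' => row_mx (const_mx (u t') : 'rV_1) (c *: v t' + _)%R : 'rV_n.+1)).
  apply: measurable_row_mx => //; apply: measurable_rowD; last exact: measurable_row_cst.
  exact: measurable_rowZ.
rewrite ge0_integralZl_EFin//; last 2 first.
- by move=> t _; exact: iint_ge0.
- by rewrite exprn_ge0// ltW.
rewrite (integral_affine (a ord0 ord0) c0)//; last by move=> t; exact: iint_ge0.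
rewrite muleA -EFinM exprSr; congr (_ * _).
apply: eq_integral => t _; apply: eq_iint => y; congr F.
rewrite [in RHS]aE.
have -> : const_mx (c * t + a ord0 ord0)%R =
    (c *: const_mx t + const_mx (a ord0 ord0))%R :> 'rV[R]_1.
  by apply/rowP => i; rewrite !mxE.
by rewrite -add_row_mx -scale_row_mx.
Qed.

Lemma iint_opp n (F : 'rV[R]_n -> \bar R) :
  borel_fun F -> (forall x, 0 <= F x) -> iint F = iint (fun x => F (- x)%R).
Proof.
elim: n F => [|n IH] F mF F0.
  by congr F; apply/rowP => -[].
rewrite /=.
transitivity (\int[lebesgue_measure]_(t in setT)
    iint (fun y : 'rV_n => F (row_mx (const_mx t : 'rV_1) (- y)%R))).
  apply: eq_integral => t _; apply: (IH (fun y : 'rV_n => F (row_mx (const_mx t : 'rV_1) y : 'rV_n.+1))) => //.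
  exact: borel_slice.
rewrite integral_opp//; last 2 first.
- apply: measurable_iint => // d T u v mu mv.
  apply: (mF _ _ (fun t' => row_mx (const_mx (u t') : 'rV_1) (- v t')%R : 'rV_n.+1)).
  apply: measurable_row_mx => //.
  under eq_fun do rewrite -scaleN1r.
  exact: measurable_rowZ.
- by move=> t; exact: iint_ge0.
apply: eq_integral => t _; apply: eq_iint => y; congr F.
have -> : const_mx (- t)%R = (- const_mx t)%R :> 'rV[R]_1.
  by apply/rowP => i; rewrite !mxE.
by rewrite -opp_row_mx.
Qed.

End iint_theory.

(** * The Prekopa-Leindler inequality *)

Section brunn_minkowski.
Variable R : realType.
Implicit Types (a b l : R).

(** With [t] the arithmetic mean, apply [ln u <= u - 1] at [x / t] and [y / t]: the weighted
    right-hand sides sum to 0. *)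
Lemma amgm2 l (x y : R) : 0 < l < 1 -> 0 < x -> 0 < y ->
  x `^ l * y `^ (1 - l) <= l * x + (1 - l) * y.
Proof.
move=> /andP[l0 l1] x0 y0; set t := l * x + (1 - l) * y.
have l1' : 0 < 1 - l by rewrite subr_gt0.
have t0 : 0 < t by rewrite addr_gt0// mulr_gt0.
have lnle (z : R) : 0 < z -> ln z <= z - 1.
  move=> z0; have := expR_ge1Dx (ln z); rewrite lnK ?posrE// => h.
  by rewrite lerBrDl.
rewrite /powR !gt_eqF// -expRD -[leRHS]lnK ?posrE// ler_expR.
have hx := lnle (x / t) (divr_gt0 x0 t0).
have hy := lnle (y / t) (divr_gt0 y0 t0).
rewrite ln_div ?posrE// in hx; rewrite ln_div ?posrE// in hy.
have : l * (ln x - ln t) + (1 - l) * (ln y - ln t) <=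
       l * (x / t - 1) + (1 - l) * (y / t - 1).
  by rewrite lerD// ler_pM2l.
have -> : l * (x / t - 1) + (1 - l) * (y / t - 1) = 0.
  have -> : l * (x / t - 1) + (1 - l) * (y / t - 1) = t / t - 1 by rewrite /t; ring.
  by rewrite divff ?subrr ?gt_eqF.
by move=> h; rewrite -subr_le0; apply: le_trans h; rewrite le_eqVlt; apply/orP; left; apply/eqP; ring.
Qed.

Lemma lebesgue_measure_le_diam (I : set R) (D : R) : I !=set0 -> measurable I ->
  (forall x y, I x -> I y -> y - x <= D) -> (lebesgue_measure I <= D%:E)%E.
Proof.
move=> [x0 Ix0] mI ID.
have half_space : has_sup I.
  by split; [exists x0|exists (x0 + D) => y Iy; rewrite -lerBlDl ID].
have D0 : 0 <= D by rewrite -(subrr x0) ID.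
apply: (@le_trans _ _ (lebesgue_measure `[sup I - D, sup I]%classic)).
  apply: le_measure; rewrite ?inE//.
  move=> x Ix /=; rewrite in_itv/=; apply/andP; split.
    rewrite lerBlDr; apply: ge_sup; first by exists x0.
    by move=> y Iy; rewrite -lerBlDl ID.
  by apply: ub_le_sup => //; case: half_space.
rewrite lebesgue_measure_itv/= lte_fin; case: ifPn => _.
  by rewrite -EFinB lee_fin opprB addrC subrK.
by rewrite lee_fin.
Qed.

Definition convex_subset (V : lmodType R) (K : set V) :=
  forall x y l, 0 < l < 1 -> K x -> K y -> K (l *: x + (1 - l) *: y).

Lemma convexS_itv (I : set R) : convex_subset (I : set R^o) -> forall x y z,
  I x -> I y -> x <= z <= y -> I z.
Proof.
move=> cI x y z Ix Iy /andP[]; rewrite le_eqVlt => /predU1P[<-//|xz].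
rewrite le_eqVlt => /predU1P[->//|zy].
have xy : 0 < y - x by rewrite subr_gt0 (lt_trans xz).
have -> : z = (y - z) / (y - x) * x + (1 - (y - z) / (y - x)) * y.
  by field; rewrite gt_eqF.
apply: cI => //; apply/andP; split; first by rewrite divr_gt0// subr_gt0.
by rewrite ltr_pdivrMr// mul1r ltrD2l ltrN2.
Qed.

(** For points [x1 <= x2] of [I] and [y1 <= y2] of [J], the set [K] contains the whole interval
    between the two combinations, of length [l (x2 - x1) + (1 - l) (y2 - y1)]. As the measure of a
    set is at most its diameter, this bound passes to the measures. *)
Lemma brunn_minkowski_line (I J K : set R) l : 0 < l < 1 ->
  I !=set0 -> J !=set0 -> convex_subset (I : set R^o) -> convex_subset (J : set R^o) ->
  measurable I -> measurable J -> measurable K ->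
  (forall x y, I x -> J y -> K (l * x + (1 - l) * y)) ->
  (l%:E * lebesgue_measure I + (1 - l)%:E * lebesgue_measure J <=
   lebesgue_measure K)%E.
Proof.
move=> /andP[l0 l1] I0 J0 cI cJ mI mJ mK IJK.
have l1' : 0 < 1 - l by rewrite subr_gt0.
have [->|Koo] := eqVneq (lebesgue_measure K) +oo%E; first by rewrite leey.
have Kfin : lebesgue_measure K \is a fin_num by rewrite ge0_fin_numE// ltey.
set k := fine (lebesgue_measure K).
have KE : lebesgue_measure K = k%:E by rewrite /k fineK.
have key x1 x2 y1 y2 : I x1 -> I x2 -> J y1 -> J y2 -> x1 <= x2 -> y1 <= y2 ->
    l * (x2 - x1) + (1 - l) * (y2 - y1) <= k.
  move=> Ix1 Ix2 Jy1 Jy2 x12 y12.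
  set p := l * x1 + (1 - l) * y1; set q := l * x2 + (1 - l) * y2.
  have pq : p <= q by rewrite lerD// ler_pM2l.
  have : (lebesgue_measure `[p, q]%classic <= lebesgue_measure K)%E.
    apply: le_measure; rewrite ?inE// => z /=; rewrite in_itv/=.
    have [pq'|] := ltP p q; last first.
      move=> qp /andP[pz zq]; have -> : z = p.
        by apply/eqP; rewrite eq_le pz (le_trans zq).
      exact: IJK.
    move=> /andP[pz zq]; set t := (z - p) / (q - p).
    have qp0 : 0 < q - p by rewrite subr_gt0.
    have t0 : 0 <= t by rewrite divr_ge0 ?(ltW qp0)// subr_ge0.
    have t1 : t <= 1 by rewrite ler_pdivrMr// mul1r lerD2r.
    have -> : z = l * (x1 + t * (x2 - x1)) + (1 - l) * (y1 + t * (y2 - y1)).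
      have -> : z = p + t * (q - p) by rewrite /t mulfVK ?gt_eqF// addrC subrK.
      by rewrite /p /q; ring.
    have between u v : u <= v -> u <= u + t * (v - u) <= v.
      move=> uv; rewrite lerDl mulr_ge0 ?subr_ge0//= addrC -lerBrDr.
      by rewrite ler_piMl// subr_ge0.
    apply: IJK.
      by apply: (convexS_itv cI Ix1 Ix2); exact: between.
    by apply: (convexS_itv cJ Jy1 Jy2); exact: between.
  rewrite lebesgue_measure_itv/= lte_fin KE; case: ifPn => [_|].
    by rewrite -EFinB lee_fin; apply: le_trans; rewrite /p /q le_eqVlt; apply/orP; left; apply/eqP; ring.
  rewrite -leNgt => qp _; apply: le_trans (_ : 0 <= k); last by rewrite /k fine_ge0.
  by apply: le_trans (_ : q - p <= 0); [rewrite /p /q le_eqVlt; apply/orP; left; apply/eqP; ring|rewrite subr_le0].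
have k0 : 0 <= k by rewrite /k fine_ge0.
(* With two points of [J] frozen, [key] bounds all differences in [I], hence the measure of [I]; the
   result then bounds all differences in [J]. *)
have key2 y1 y2 : J y1 -> J y2 -> y1 <= y2 ->
    (lebesgue_measure I <= ((k - (1 - l) * (y2 - y1)) / l)%:E)%E.
  move=> Jy1 Jy2 y12; apply: lebesgue_measure_le_diam => // x1 x2 Ix1 Ix2.
  rewrite ler_pdivlMr// mulrC lerBrDr.
  have [x12|/ltW x21] := leP x1 x2; first exact: key.
  apply: le_trans (key x1 x1 y1 y2 Ix1 Ix1 Jy1 Jy2 (lexx _) y12).
  by rewrite lerD2r subrr mulr0 mulr_ge0_le0 ?subr_le0// ltW.
have Ifin : lebesgue_measure I \is a fin_num.
  rewrite ge0_fin_numE//; case: J0 => y Jy.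
  by apply: le_lt_trans (key2 y y Jy Jy (lexx _)) _; rewrite ltry.
have I0' : 0 <= fine (lebesgue_measure I) by rewrite fine_ge0.
have key3 : (lebesgue_measure J <=
    ((k - l * fine (lebesgue_measure I)) / (1 - l))%:E)%E.
  apply: lebesgue_measure_le_diam => // y1 y2 Jy1 Jy2.
  rewrite ler_pdivlMr// mulrC.
  have kl z w : J z -> J w -> z <= w -> (1 - l) * (w - z) <= k - l * fine (lebesgue_measure I).
    move=> Jz Jw zw; have := key2 _ _ Jz Jw zw.
    rewrite -{1}(fineK Ifin) lee_fin ler_pdivlMr// => h; lra.
  have [y12|/ltW y21] := leP y1 y2; first exact: kl.
  apply: le_trans (kl y1 y1 Jy1 Jy1 (lexx _)).
  by rewrite subrr mulr0 mulr_ge0_le0 ?subr_le0// ltW.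
have Jfin : lebesgue_measure J \is a fin_num.
  by rewrite ge0_fin_numE//; apply: le_lt_trans key3 _; rewrite ltry.
move: key3; rewrite KE -(fineK Ifin) -(fineK Jfin) -!EFinM -EFinD !lee_fin /=.
by rewrite ler_pdivlMr// => h; lra.
Qed.

End brunn_minkowski.

(** * The layer-cake formula for truncated functions *)

Section layer_cake_formula.
Variable R : realType.

(** The region under the graph of [F / a], cut off at height 1. Normalized heights let functions
    with different suprema be compared at the same [s]. *)
Definition level_set (F : R -> \bar R) (a : R) : set (measurableTypeR R * measurableTypeR R) :=
  [set xs | 0 < xs.2 < 1 /\ ((a * xs.2)%:E <= F xs.1)%E].

Lemma measurable_level_set (F : R -> \bar R) a : measurable_fun setT F ->
  measurable (level_set F a).
Proof.
move=> mF.
have -> : level_set F a = (snd @^-1` `]0, 1[%classic) `&`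
    ((fun xs => F xs.1 - (a * xs.2)%:E)%E @^-1` `[0%E, +oo[%classic).
  apply/seteqP; split => -[x s] /=; rewrite !in_itv/= andbT.
    by move=> [-> h]; split=> //; rewrite EFinN sube_ge0// orbT.
  by move=> [s01]; rewrite EFinN sube_ge0 ?orbT// => h; split.
apply: measurableI.
  by rewrite -[X in measurable X]setTI; exact: measurable_snd.
rewrite -[X in measurable X]setTI.
have mG : measurable_fun setT (fun xs : measurableTypeR R * measurableTypeR R =>
    F xs.1 - (a * xs.2)%:E)%E.
  apply: emeasurable_funB.
    exact: (measurableT_comp (f := F)).
  apply/measurable_EFinP; exact: measurable_funM.
by apply: mG => //; exact: emeasurable_itv.
Qed.

Lemma layer_cake (F : R -> \bar R) a : measurable_fun setT F ->
  (forall x, 0 <= F x)%E -> 0 < a ->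
  (\int[lebesgue_measure]_x mine (F x) a%:E =
   a%:E * \int[lebesgue_measure]_s lebesgue_measure (ysection (level_set F a) s))%E.
Proof.
move=> mF F0 a0.
have mS := measurable_level_set a mF.
have mI : measurable_fun setT (fun xs => (\1_(level_set F a) xs)%:E : \bar R).
  by apply/measurable_EFinP; exact: measurable_indic.
transitivity (a%:E * \int[lebesgue_measure]_x
    \int[lebesgue_measure]_s (\1_(level_set F a) (x, s))%:E)%E; last first.
  rewrite (fubini_tonelli (fun xs : measurableTypeR R * measurableTypeR R =>
    (\1_(level_set F a) xs)%:E))//.
  congr (_ * _)%E; apply: eq_integral => s _.
  rewrite -[X in _ = lebesgue_measure X]setIT -integral_indic//; last exact: measurable_ysection.
  by apply: eq_integral => x _; rewrite !indicE mem_ysection.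
rewrite -ge0_integralZl_EFin//; last 3 first.
- by move=> x _; apply: integral_ge0 => s _; rewrite lee_fin.
- exact: (measurable_fun_fubini_tonelli_F _ mI).
- exact: ltW.
apply: eq_integral => x _.
transitivity (a%:E * lebesgue_measure (xsection (level_set F a) x))%E; last first.
  congr (_ * _)%E.
  rewrite -[X in lebesgue_measure X = _]setIT -integral_indic//; last exact: measurable_xsection.
  by apply: eq_integral => s _; rewrite !indicE mem_xsection.
have xE : xsection (level_set F a) x =
    [set s | 0 < s < 1 /\ ((a * s)%:E <= F x)%E] :> set R.
  by apply/seteqP; split => s /=; rewrite /xsection /= inE.
rewrite xE.
have hfull : (a%:E <= F x)%E ->
    [set s | 0 < s < 1 /\ ((a * s)%:E <= F x)%E] = `]0, 1[%classic :> set R.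
  move=> aF; apply/seteqP; split => s /=; rewrite in_itv/=; first by case.
  move=> /andP[s0 s1]; split; first by rewrite s0.
  by apply: le_trans aF; rewrite lee_fin ler_piMr// ltW.
have [aF|Fa] := leP a%:E (F x).
  by rewrite hfull// lebesgue_measure_itv/= lte_fin ltr01 -EFinB subr0 mule1.
have := F0 x; move: Fa; case: (F x) => [r| |]//; rewrite lte_fin lee_fin => ra r0.
have -> : [set s | 0 < s < 1 /\ ((a * s)%:E <= r%:E)%E] = `]0, r / a]%classic :> set R.
  apply/seteqP; split => s /=; rewrite in_itv/= lee_fin ler_pdivlMr// mulrC.
    by move=> [/andP[-> _] ->].
  move=> /andP[s0 sr]; split => //; rewrite s0/=.
  by rewrite -(ltr_pM2l a0) mulr1 (le_lt_trans _ ra)// mulrC.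
rewrite lebesgue_measure_itv/= lte_fin.
rewrite pmulr_lgt0 ?invr_gt0//; case: ifPn => [_|].
  by rewrite -EFinB subr0 -EFinM mulrCA divff ?gt_eqF// mulr1.
rewrite -leNgt => r0'; have -> : r = 0 by apply/eqP; rewrite eq_le r0' r0.
by rewrite mule0.
Qed.

End layer_cake_formula.

(** * From the line to marginals in all dimensions *)

Section prekopa_leindler.
Variable R : realType.

Lemma powR_onem (s l : R) : 0 < s -> s `^ l * s `^ (1 - l) = s.
Proof.
move=> s0; rewrite -powRD; last by apply/implyP => _; rewrite gt_eqF.
by rewrite addrC subrK powRr1// ltW.
Qed.

Lemma ysection_level_set (F : R -> \bar R) a s : 0 < s < 1 ->
  ysection (level_set F a) s = [set x | ((a * s)%:E <= F x)%E].
Proof.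
move=> s01; rewrite ysectionE; apply/seteqP; split => x /=; first by case.
by move=> h; split.
Qed.

Lemma ysection_level_set0 (F : R -> \bar R) a s : ~~ (0 < s < 1) ->
  ysection (level_set F a) s = set0.
Proof.
move=> /negP s01; rewrite ysectionE; apply/seteqP; split => x //=.
by case => /= /s01.
Qed.

(** Brunn-Minkowski needs nonempty level sets, while [f] may be unbounded. Monotone convergence
    yields an [n] for which the integral of [min(f, n)] still exceeds [P]; then [a] is the supremum
    of [min(f, n)], so that every level below [a] is reached. *)
Lemma exists_truncation (f : R -> \bar R) (P : R) : measurable_fun setT f ->
  (forall x, 0 <= f x)%E -> 0 <= P ->
  (P%:E < \int[lebesgue_measure]_x f x)%E ->
  exists a, [/\ 0 < a, (P%:E <= \int[lebesgue_measure]_x mine (f x) a%:E)%E &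
    forall s, 0 < s < 1 -> exists x, ((a * s)%:E <= f x)%E].
Proof.
move=> mf f0 P0 Pf.
have mmin (a : \bar R) : measurable_fun setT (fun x => mine (f x) a).
  by apply: measurable_mine.
have min0 (n : nat) x : (0 <= mine (f x) n%:R%:E)%E.
  by rewrite le_min f0 lee_fin ler0n.
have [n Pn] : exists n : nat, (P%:E < \int[lebesgue_measure]_x mine (f x) n%:R%:E)%E.
  apply: contrapT => /forallNP H.
  have Hc : (\int[lebesgue_measure]_x mine (f x) n%:R%:E @[n --> \oo] -->
      \int[lebesgue_measure]_x f x)%E.
    rewrite (_ : (\int[lebesgue_measure]_x f x)%E = (\int[lebesgue_measure]_x
       limn (fun n => mine (f x) n%:R%:E))%E); last first.
      apply: eq_integral => x _; apply/esym/cvg_lim => //.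
      have := f0 x; case: (f x) => [r r0| _|//].
        apply: cvg_near_cst.
        near=> n; apply: min_l; rewrite lee_fin.
        by near: n; exact: nbhs_infty_ger.
      under eq_fun do rewrite minye.
      exact/cvgeryP/cvgr_idn.
    apply: (@cvg_monotone_convergence _ _ _ lebesgue_measure setT measurableT
      (fun n x => mine (f x) n%:R%:E)) => //.
      by move=> k; exact: mmin.
    move=> x _ m n mn.
    by rewrite le_min ge_min lexx/= ge_min lee_fin ler_nat mn orbT.
  move: Pf; rewrite ltNge => /negP; apply.
  rewrite -(cvg_lim _ Hc)//; apply: lime_le; first exact: cvgP Hc.
  by apply: nearW => n; rewrite leNgt; apply/negP; exact: H.
pose S := ereal_sup (range (fun x => mine (f x) n%:R%:E)).
have Sub x : (mine (f x) n%:R%:E <= S)%E by apply: ereal_sup_ubound; exists x.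
have SN : (S <= n%:R%:E)%E.
  by apply: ge_ereal_sup => _ [x _ <-]; rewrite ge_min lexx orbT.
have S0 : (0 < S)%E.
  rewrite ltNge; apply/negP => S0; move: Pn; rewrite ltNge => /negP; apply.
  rewrite integral0_eq ?lee_fin// => x _; apply/eqP; rewrite eq_le min0 andbT.
  exact: le_trans S0.
have Sfin : S \is a fin_num.
  by rewrite gt0_fin_numE//; apply: le_lt_trans SN _; rewrite ltry.
exists (fine S); split; first by rewrite -lte_fin fineK.
  apply: le_trans (ltW Pn) _; apply: le_integralT => // x.
  by rewrite fineK// le_min Sub ge_min lexx.
move=> s /andP[s0 s1].
have : ((fine S * s)%:E < S)%E.
  by rewrite -[X in (_ < X)%E]fineK// lte_fin gtr_pMr// -lte_fin fineK.
move=> /ereal_sup_gt [_ [x _ <-]] h; exists x.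
by apply: le_trans (ltW h) _; rewrite ge_min lexx.
Unshelve. all: by end_near.
Qed.

(** With [c = a^l b^(1-l)], the set [{h >= c s}] contains the combination of [{f >= a s}] and
    [{g >= b s}], because [(a s)^l (b s)^(1-l) = c s]. Integrate Brunn-Minkowski over [s], then pass
    from the arithmetic to the geometric mean of [P / a] and [Q / b]. *)
Lemma prekopa_leindler_trunc (f g h : R -> \bar R) l (a b P Q : R) :
  0 < l < 1 ->
  measurable_fun setT f -> measurable_fun setT g -> measurable_fun setT h ->
  (forall x, 0 <= f x)%E -> (forall x, 0 <= g x)%E -> (forall x, 0 <= h x)%E ->
  (forall c : R, convex_subset ([set x | (c%:E <= f x)%E] : set R^o)) ->
  (forall c : R, convex_subset ([set x | (c%:E <= g x)%E] : set R^o)) ->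
  (forall x y (u v : R), 0 < u -> 0 < v -> (u%:E <= f x)%E -> (v%:E <= g y)%E ->
     ((u `^ l * v `^ (1 - l))%:E <= h (l * x + (1 - l) * y)%R)%E) ->
  0 < a -> 0 < b ->
  (forall s, 0 < s < 1 -> exists x, ((a * s)%:E <= f x)%E) ->
  (forall s, 0 < s < 1 -> exists x, ((b * s)%:E <= g x)%E) ->
  0 < P -> 0 < Q ->
  (P%:E <= \int[lebesgue_measure]_x mine (f x) a%:E)%E ->
  (Q%:E <= \int[lebesgue_measure]_x mine (g x) b%:E)%E ->
  ((P `^ l * Q `^ (1 - l))%:E <= \int[lebesgue_measure]_x h x)%E.
Proof.
move=> l01 mf mg mh f0 g0 h0 cf cg fgh a0 b0 fa gb P0 Q0 Pf Qg.
have /andP[l0 l1] := l01; have l1' : 0 < 1 - l by rewrite subr_gt0.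
set c := a `^ l * b `^ (1 - l).
have c0 : 0 < c by rewrite mulr_gt0// powR_gt0.
rewrite layer_cake// in Pf; rewrite layer_cake// in Qg.
set U := (X in (a%:E * X)%E) in Pf; set W := (X in (b%:E * X)%E) in Qg.
have mys F d : measurable_fun setT F -> measurable_fun setT
    (fun s => lebesgue_measure (ysection (@level_set R F d) s)).
  by move=> mF; apply: measurable_fun_ysection; exact: measurable_level_set.
apply: (@le_trans _ _ (c%:E * (l%:E * U + (1 - l)%:E * W))%E); last first.
  apply: (@le_trans _ _ (\int[lebesgue_measure]_x mine (h x) c%:E)%E); last first.
    apply: le_integralT => x; first by rewrite le_min h0 lee_fin ltW.
    by rewrite ge_min lexx.
  rewrite layer_cake//; apply: lee_pmul => //.
  - by rewrite lee_fin ltW.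
  - by rewrite adde_ge0// mule_ge0 ?lee_fin ?(ltW l0) ?(ltW l1')//; exact: integral_ge0.
  rewrite /U /W -!ge0_integralZl_EFin//; [|exact: mys|exact: ltW|exact: mys|exact: ltW].
  rewrite -ge0_integralD//; first last.
  - by apply: measurable_funeM; exact: mys.
  - by move=> x _; rewrite mule_ge0// lee_fin ltW.
  - by apply: measurable_funeM; exact: mys.
  - by move=> x _; rewrite mule_ge0// lee_fin ltW.
  apply: le_integralT => s.
    by rewrite adde_ge0// mule_ge0// lee_fin ltW.
  have [s01|s01] := boolP (0 < s < 1); last by rewrite !ysection_level_set0// measure0 !mule0 adde0.
  have /andP[s0 s1] := s01.
  apply: brunn_minkowski_line => //.
  - by have [x xf] := fa _ s01; exists x; rewrite ysection_level_set.
  - by have [x xf] := gb _ s01; exists x; rewrite ysection_level_set.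
  - by rewrite ysection_level_set//; exact: cf.
  - by rewrite ysection_level_set//; exact: cg.
  - by apply: measurable_ysection; exact: measurable_level_set.
  - by apply: measurable_ysection; exact: measurable_level_set.
  - by apply: measurable_ysection; exact: measurable_level_set.
  rewrite !ysection_level_set// => x y /= fx gy.
  have -> : c * s = (a * s) `^ l * (b * s) `^ (1 - l).
    by rewrite !powRM ?(ltW a0) ?(ltW b0) ?(ltW s0)// mulrACA powR_onem.
  by apply: fgh => //; rewrite mulr_gt0.
have PU : ((P / a)%:E <= U)%E.
  by rewrite -(@lee_pmul2l _ a%:E)// -EFinM mulrCA divff ?gt_eqF// mulr1.
have QW : ((Q / b)%:E <= W)%E.
  by rewrite -(@lee_pmul2l _ b%:E)// -EFinM mulrCA divff ?gt_eqF// mulr1.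
apply: (@le_trans _ _ (c%:E * (l%:E * (P / a)%:E + (1 - l)%:E * (Q / b)%:E))%E).
  rewrite -!EFinM lee_fin.
  have -> : P `^ l * Q `^ (1 - l) = c * ((P / a) `^ l * (Q / b) `^ (1 - l)).
    rewrite /c mulrACA -!powRM ?divr_ge0 ?(ltW a0) ?(ltW b0) ?(ltW P0) ?(ltW Q0)//.
    by rewrite mulrCA divff ?gt_eqF// mulr1 mulrCA divff ?gt_eqF// mulr1.
  by rewrite ler_pM2l//; apply: amgm2 => //; exact: divr_gt0.
by rewrite lee_pmul2l// leeD// lee_pmul2l.
Qed.

Lemma prekopa_leindler_line (f g h : R -> \bar R) l (A B : R) :
  0 < l < 1 ->
  measurable_fun setT f -> measurable_fun setT g -> measurable_fun setT h ->
  (forall x, 0 <= f x)%E -> (forall x, 0 <= g x)%E -> (forall x, 0 <= h x)%E ->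
  (forall c : R, convex_subset ([set x | (c%:E <= f x)%E] : set R^o)) ->
  (forall c : R, convex_subset ([set x | (c%:E <= g x)%E] : set R^o)) ->
  (forall x y (u v : R), 0 < u -> 0 < v -> (u%:E <= f x)%E -> (v%:E <= g y)%E ->
     ((u `^ l * v `^ (1 - l))%:E <= h (l * x + (1 - l) * y)%R)%E) ->
  0 < A -> 0 < B ->
  (A%:E <= \int[lebesgue_measure]_x f x)%E ->
  (B%:E <= \int[lebesgue_measure]_x g x)%E ->
  ((A `^ l * B `^ (1 - l))%:E <= \int[lebesgue_measure]_x h x)%E.
Proof.
move=> l01 mf mg mh f0 g0 h0 cf cg fgh A0 B0 Af Bg.
(* Shrinking both bounds by [t < 1] gives the strict inequalities that the truncation needs; the
   conclusion is homogeneous of degree 1 in [t]. *)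
apply/lee_mul01Pr; first by rewrite lee_fin mulr_ge0 ?powR_ge0.
move=> t /andP[t0 t1].
have lt (C : R) (F : R -> \bar R) : 0 < C -> (C%:E <= \int[lebesgue_measure]_x F x)%E ->
    ((t * C)%:E < \int[lebesgue_measure]_x F x)%E.
  by move=> C0; apply: lt_le_trans; rewrite lte_fin gtr_pMl.
have tA : 0 < t * A by rewrite mulr_gt0.
have tB : 0 < t * B by rewrite mulr_gt0.
have [a [a0 Pa fa]] := exists_truncation mf f0 (ltW tA) (lt _ _ A0 Af).
have [b [b0 Qb gb]] := exists_truncation mg g0 (ltW tB) (lt _ _ B0 Bg).
have := prekopa_leindler_trunc l01 mf mg mh f0 g0 h0 cf cg fgh a0 b0 fa gb tA tB Pa Qb.
rewrite !powRM ?(ltW t0) ?(ltW A0) ?(ltW B0)// mulrACA.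
by rewrite powR_onem// EFinM.
Qed.

(* Stated through real lower bounds, so that no power of [+oo] is needed. *)
Definition log_concave_ext (V : lmodType R) (F : V -> \bar R) :=
  forall x y (l a b : R), 0 < l < 1 -> 0 < a -> 0 < b ->
    (a%:E <= F x)%E -> (b%:E <= F y)%E ->
    ((a `^ l * b `^ (1 - l))%:E <= F (l *: x + (1 - l) *: y)%R)%E.

Lemma log_concave_ext_superlevel (V : lmodType R) (F : V -> \bar R) (c : R) :
  (forall x, 0 <= F x)%E -> log_concave_ext F -> convex_subset [set x | (c%:E <= F x)%E].
Proof.
move=> F0 cF x y l l01 /= cx cy.
have [c0|c0] := leP c 0; first by apply: le_trans (F0 _); rewrite lee_fin.
have := cF x y l c c l01 c0 c0 cx cy.
by rewrite powR_onem.
Qed.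

Lemma log_concave_integral (V : lmodType R) (G : V -> R -> \bar R) :
  log_concave_ext (fun w : V * R^o => G w.1 w.2) ->
  (forall u, measurable_fun setT (G u)) -> (forall u t, 0 <= G u t)%E ->
  log_concave_ext (fun u => \int[lebesgue_measure]_t G u t)%E.
Proof.
move=> cG mG G0 u v l A B l01 A0 B0 AG BG.
have cs w (c : R) : convex_subset ([set x | (c%:E <= G w x)%E] : set R^o).
  apply: log_concave_ext_superlevel; first exact: G0.
  move=> x y l' a b l01' a0 b0 ax by_.
  have := cG (w, x) (w, y) l' a b l01' a0 b0 ax by_.
  have wE : l' *: w + (1 - l') *: w = w by rewrite -scalerDl addrC subrK scale1r.
  by rewrite /= wE.
apply: (prekopa_leindler_line l01 (mG u) (mG v)) => //.
by move=> x y a b a0 b0 ax by_; exact: (cG (u, x) (v, y) l a b l01 a0 b0 ax by_).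
Qed.

(** The induction moves one integration variable into the parameter space, hence the arbitrary
    module [V]. *)
Lemma log_concave_iint n (V : lmodType R) (G : V -> 'rV[R]_n -> \bar R) :
  log_concave_ext (fun w : V * 'rV[R]_n => G w.1 w.2) ->
  (forall u, borel_fun (G u)) -> (forall u x, 0 <= G u x)%E ->
  log_concave_ext (fun u => iint (G u)).
Proof.
elim: n V G => [|n IH] V G cG mG G0.
  move=> x y l a b l01 a0 b0 /= ax by_.
  have := cG (x, 0) (y, 0) l a b l01 a0 b0 ax by_.
  by rewrite /= !scaler0 addr0.
apply: (log_concave_integral (G := fun u t => iint (fun y : 'rV_n => G u (row_mx (const_mx t : 'rV_1) y)))).
- apply: (IH (V * R^o)%type (fun w y => G w.1 (row_mx (const_mx w.2 : 'rV_1) y : 'rV_n.+1))) => //.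
    move=> [[u s] x] [[v t] y] l a b l01 a0 b0 /= ax by_.
    have := cG (u, row_mx (const_mx s : 'rV_1) x : 'rV_n.+1)
      (v, row_mx (const_mx t : 'rV_1) y : 'rV_n.+1) l a b l01 a0 b0 ax by_.
    congr (_ <= G _ _)%E => /=.
    have -> : const_mx (l * s + (1 - l) * t) = l *: const_mx s + (1 - l) *: const_mx t :> 'rV[R]_1.
      by apply/rowP => i; rewrite !mxE.
    by rewrite -add_row_mx -!scale_row_mx.
  by move=> w; exact: borel_slice.
- by move=> u; exact: measurable_slice.
- by move=> u t; exact: iint_ge0.
Qed.

End prekopa_leindler.

(** * Boundaries of convex sets and Borel versions of log-concave functions *)

Section boundary.
Variable R : realType.

Definition cube n (x : 'rV[R]_n) (r : R) : set 'rV[R]_n :=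
  [set y | forall i, `|y 0 i - x 0 i| < r].

Definition cube_interior n (K : set 'rV[R]_n) : set 'rV[R]_n :=
  [set x | exists2 r, 0 < r & cube x r `<=` K].

(** The cone with a cube in slice [t] as base and a point of slice [t2] as apex contains all points
    near [(t, y)] that lie strictly on the side of [t2]. *)
Lemma cone_nbhs n (K : set 'rV[R]_n.+1) (t t2 : R) (y y2 : 'rV[R]_n) r :
  convex_subset K -> 0 < r -> t2 != t ->
  (forall w, cube y r w -> K (row_mx (const_mx t : 'rV_1) w)) ->
  K (row_mx (const_mx t2 : 'rV_1) y2) ->
  exists2 p, 0 < p & forall s z, 0 < (s - t) / (t2 - t) -> `|s - t| < p ->
    cube y p z -> K (row_mx (const_mx s : 'rV_1) z).
Proof.
move=> cK r0 tt2 Kt K2; set d := t2 - t.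
have d0 : 0 < `|d| by rewrite normr_gt0 subr_eq0.
set M := \sum_i `|y2 0 i - y 0 i|.
have M0 : 0 <= M by exact: sumr_ge0.
have Mi i : `|y2 0 i - y 0 i| <= M by rewrite /M (bigD1 i)//= lerDl sumr_ge0.
have q0 : 0 < 1 + M / `|d| by rewrite ltr_pwDl// divr_ge0.
(* The first bound keeps [u < 1/2]; by the second, the base point [w] of the ray from the apex
   through [(s, z)] stays within [r] of [y]. *)
exists (Num.min (`|d| / 2) (r / (2 * (1 + M / `|d|)))).
  by rewrite lt_min !divr_gt0// mulr_gt0.
set p := Num.min _ _ => s z; set u := (s - t) / d => u0 sp zp.
have u12 : u < 1 / 2.
  rewrite -[u]gtr0_norm// /u normrM normfV ltr_pdivrMr//.
  by apply: (lt_le_trans sp); rewrite ge_min mul1r mulrC lexx.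
have u1 : 0 < 1 - u by lra.
have pr : 2 * p * (1 + M / `|d|) <= r.
  have : p <= r / (2 * (1 + M / `|d|)) by rewrite ge_min lexx orbT.
  by rewrite ler_pdivlMr ?mulr_gt0// => h; apply: le_trans h; rewrite mulrA [p * 2]mulrC.
pose w := (1 - u)^-1 *: (z - u *: y2).
have wc : cube y r w.
  move=> i; rewrite !mxE.
  have -> : (1 - u)^-1 * (z 0 i - u * y2 0 i) - y 0 i =
      (1 - u)^-1 * ((z 0 i - y 0 i) - u * (y2 0 i - y 0 i)).
    by field; rewrite gt_eqF.
  rewrite normrM gtr0_norm ?invr_gt0// mulrC ltr_pdivrMr//.
  apply: (le_lt_trans (ler_normB _ _)).
  rewrite normrM gtr0_norm//.
  have h1 := zp i; have h2 := Mi i.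
  have h3 : u * `|y2 0 i - y 0 i| <= p * (M / `|d|).
    have -> : p * (M / `|d|) = p / `|d| * M by field; rewrite gt_eqF.
    apply: ler_pM => //; first exact: ltW.
    rewrite -[u]gtr0_norm// /u normrM normfV ler_pM2r ?invr_gt0//; exact: ltW.
  have h4 : r / 2 <= r * (1 - u) by rewrite ler_pM2l//; lra.
  have : 2 * (`|z 0 i - y 0 i| + u * `|y2 0 i - y 0 i|) < 2 * p * (1 + M / `|d|).
    by rewrite -mulrA ltr_pM2l// mulrDr mulr1 ltr_leD.
  move=> h5; lra.
have -> : row_mx (const_mx s : 'rV_1) z = (1 - u) *: row_mx (const_mx t : 'rV_1) w
    + (1 - (1 - u)) *: row_mx (const_mx t2 : 'rV_1) y2.
  rewrite !scale_row_mx add_row_mx; congr row_mx.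
    apply/rowP => i; rewrite !mxE.
    have -> : s = t + u * d by rewrite /u mulfVK -?normr_gt0// addrC subrK.
    by rewrite /d; ring.
  by rewrite /w scalerA divff ?gt_eqF// scale1r subKr subrK.
by apply: cK => //; [lra|exact: Kt].
Qed.

Lemma row_mx_split n (v : 'rV[R]_n.+1) :
  v = row_mx (const_mx (v 0 0) : 'rV_1) (rsubmx (v : 'rV_(1 + n))).
Proof.
have <- : lsubmx (v : 'rV_(1 + n)) = const_mx (v 0 0); last by rewrite hsubmxK.
by apply/rowP => i; rewrite !mxE; congr (v _ _); apply/val_inj; rewrite /= !ord1.
Qed.

Lemma row_mx_head n (t : R) (y : 'rV[R]_n) :
  (row_mx (const_mx t : 'rV_1) y : 'rV_n.+1) 0 0 = t.
Proof.
transitivity ((row_mx (const_mx t : 'rV[R]_1) y) 0 (lshift n 0)).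
  by congr (row_mx _ _ _ _); exact: val_inj.
by rewrite row_mxEl mxE.
Qed.

Lemma row_mx_tail n (t : R) (y : 'rV[R]_n) i :
  (row_mx (const_mx t : 'rV_1) y : 'rV_n.+1) 0 (rshift 1 i) = y 0 i.
Proof. exact: row_mxEr. Qed.

Lemma row_mx_lift n (t : R) (y : 'rV[R]_n) i :
  (row_mx (const_mx t : 'rV_1) y : 'rV_n.+1) 0 (lift 0 i) = y 0 i.
Proof.
by rewrite -[RHS](row_mx_tail t); congr (row_mx _ _ _ _); exact: val_inj.
Qed.

Lemma row_mx_comb n (l m s t : R) (x y : 'rV[R]_n) :
  l *: (row_mx (const_mx s : 'rV_1) x : 'rV_n.+1) +
  m *: (row_mx (const_mx t : 'rV_1) y : 'rV_n.+1) =
  row_mx (const_mx (l * s + m * t) : 'rV_1) (l *: x + m *: y).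
Proof.
have -> : const_mx (l * s + m * t) = l *: const_mx s + m *: const_mx t :> 'rV[R]_1.
  by apply/rowP => i; rewrite !mxE.
by rewrite -add_row_mx -!scale_row_mx.
Qed.

Lemma cube_row_mx n (t : R) (y : 'rV[R]_n) r s z :
  cube (row_mx (const_mx t : 'rV_1) y : 'rV_n.+1) r (row_mx (const_mx s : 'rV_1) z) ->
  `|s - t| < r /\ cube y r z.
Proof.
move=> h; split; first by have := h 0; rewrite !row_mx_head.
by move=> i; have := h (rshift 1 i); rewrite !row_mx_tail.
Qed.

Lemma intr_slice n (K : set 'rV[R]_n.+1) (t t1 t2 : R) (y y1 y2 : 'rV[R]_n) :
  convex_subset K -> t1 < t < t2 ->
  K (row_mx (const_mx t1 : 'rV_1) y1) -> K (row_mx (const_mx t2 : 'rV_1) y2) ->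
  cube_interior [set w | K (row_mx (const_mx t : 'rV_1) w)] y ->
  cube_interior K (row_mx (const_mx t : 'rV_1) y).
Proof.
move=> cK /andP[t1t tt2] K1 K2 [r r0 Kr].
have n1 : t1 != t by rewrite lt_eqF.
have n2 : t2 != t by rewrite gt_eqF.
have [p1 p10 H1] := cone_nbhs cK r0 n1 Kr K1.
have [p2 p20 H2] := cone_nbhs cK r0 n2 Kr K2.
exists (Num.min r (Num.min p1 p2)); first by rewrite !lt_min r0 p10.
move=> v; rewrite (row_mx_split v); set s := v 0 0; set z := rsubmx _.
move=> /cube_row_mx[]; rewrite !lt_min => /and3P[sr s1 s2] zc.
have zc' p : Num.min r (Num.min p1 p2) <= p -> cube y p z.
  by move=> h i; apply: lt_le_trans h.
have [st|ts|st] := ltgtP s t.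
- apply: H1 => //; last by apply: zc'; rewrite !ge_min lexx !orbT.
  by rewrite -mulrNN -invrN !opprB divr_gt0// subr_gt0.
- apply: H2 => //; last by apply: zc'; rewrite !ge_min lexx !orbT.
  by rewrite divr_gt0// subr_gt0.
- by rewrite st; apply: Kr; apply: zc'; rewrite !ge_min lexx.
Qed.

(** Attained endpoints, at most two: the slice of a convex set over such a point may lie wholly in
    its boundary. *)
Definition extremal (J : set R) : set R :=
  [set t | J t /\ ((forall s, J s -> s <= t) \/ (forall s, J s -> t <= s))].

Lemma countable_extremal (J : set R) : countable (extremal J).
Proof.
have sub1 (A : set R) : (forall x y, A x -> A y -> x = y) -> countable A.
  move=> h; have [->|/set0P[x Ax]] := eqVneq A set0; first exact: countable0.
  apply: (sub_countable (B := [set x])); last exact: countable1.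
  by apply: subset_card_le => y Ay /=; exact: h.
have -> : extremal J = [set t | J t /\ forall s, J s -> s <= t] `|`
    [set t | J t /\ forall s, J s -> t <= s].
  apply/seteqP; split => t /=; first by move=> [Jt []]; [left|right].
  by move=> [] [Jt h]; split => //; [left|right].
rewrite -bigcup2E; apply: bigcup_countable => // -[|[|k]] _ /=.
- apply: sub1 => x y [Jx hx] [Jy hy]; apply/eqP.
  by rewrite eq_le hx// hy.
- apply: sub1 => x y [Jx hx] [Jy hy]; apply/eqP.
  by rewrite eq_le hx// hy.
- exact: countable0.
Qed.

(* Lebesgue-null boundaries: a slice of the boundary of a convex set lies in
   the boundary of the slice, except for the two extreme slices. *)
Lemma iint_eq_off_boundary n (K : nat -> set 'rV[R]_n) (F G : 'rV[R]_n -> \bar R) :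
  (forall i, convex_subset (K i)) ->
  (forall x, (forall i, K i x -> cube_interior (K i) x) -> F x = G x) ->
  iint F = iint G.
Proof.
elim: n K F G => [|n IH] K F G cK FG /=.
  by apply: FG => i K0; exists 1 => // y _; rewrite (_ : y = 0)//; apply/rowP => -[].
pose J i := [set t | exists y, K i (row_mx (const_mx t : 'rV_1) y)].
pose N := \bigcup_i extremal (J i).
have cN : countable N.
  by apply: bigcup_countable => // i _; exact: countable_extremal.
apply: (@integralE_off _ (measurableTypeR R) R lebesgue_measure N).
  exact: countable_measurable.
  exact: countable_lebesgue_measure0.
move=> t Nt; apply: (IH (fun i => [set w | K i (row_mx (const_mx t : 'rV_1) w)])).
  move=> i x y l l01 /= Kx Ky.
  have := cK i _ _ l l01 Kx Ky.
  by rewrite row_mx_comb (_ : l * t + (1 - l) * t = t)//; ring.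
move=> y hy; apply: FG => i Kty.
have Jt : J i t by exists y.
have [t1 [y1 K1] t1t] : exists2 s, J i s & s < t.
  apply: contrapT => H; apply: Nt; exists i => //; split => //; right => s Js.
  by rewrite leNgt; apply/negP => st; apply: H; exists s.
have [t2 [y2 K2] tt2] : exists2 s, J i s & t < s.
  apply: contrapT => H; apply: Nt; exists i => //; split => //; left => s Js.
  by rewrite leNgt; apply/negP => st; apply: H; exists s.
by apply: (intr_slice (cK i) _ K1 K2); [rewrite t1t|exact: hy].
Qed.

End boundary.

(** * Lower semicontinuous envelopes *)

Section regularization.
Variable R : realType.
Variable n : nat.
Implicit Types (f : 'rV[R]_n -> R) (x y : 'rV[R]_n).

Definition ratcube (i : 'rV[rat]_n * nat) : set 'rV[R]_n :=
  cube (\row_j ratr (i.1 0 j)) (i.2.+1%:R^-1).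

(** The infimum of [f] over the k-th rational cube, on that cube. There are countably many, so their
    supremum is measurable; the default 0 is harmless for [f >= 0]. *)
Definition bump f (k : nat) x : \bar R :=
  if unpickle k is Some i then
    if `[< ratcube i x >] then ereal_inf [set (f y)%:E | y in ratcube i] else 0%E
  else 0%E.

Definition lsc_env f x : \bar R := esups (fun k => bump f k x) 0.

Lemma lsc_envE f x : lsc_env f x = ereal_sup (range (fun k => bump f k x)).
Proof.
rewrite /lsc_env /esups /sdrop; congr ereal_sup.
by apply/seteqP; split => _ [k _ <-]; exists k.
Qed.

Lemma lsc_env_le f x : (forall x, 0 <= f x) -> (lsc_env f x <= (f x)%:E)%E.
Proof.
move=> f0; rewrite lsc_envE; apply: ge_ereal_sup => _ [k _ <-].
rewrite /bump; case: unpickle => [i|]; last by rewrite lee_fin.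
case: ifPn => [/asboolP ix|_]; last by rewrite lee_fin.
by apply: ereal_inf_lbound; exists x.
Qed.

Lemma lsc_env_ge0 f x : (forall x, 0 <= f x) -> (0 <= lsc_env f x)%E.
Proof.
move=> f0; rewrite lsc_envE; apply: (@le_trans _ _ (bump f 0 x)); last first.
  by apply: ereal_sup_ubound; exists 0%N.
rewrite /bump; case: unpickle => [i|]; last by rewrite lee_fin.
case: ifPn => _ //.
by apply: le_ereal_inf_tmp => _ [y _ <-]; rewrite lee_fin.
Qed.

Lemma ratcube_nbhs x r : 0 < r -> exists2 i, ratcube i x & ratcube i `<=` cube x r.
Proof.
move=> r0.
have [k kr] : exists k : nat, (k.+1%:R : R)^-1 < r / 2.
  have [k /= Hk] : exists k : nat, (r / 2)^-1 < k%:R.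
    exists (Num.bound (r / 2)^-1); apply: archi_boundP.
    by rewrite invr_ge0 divr_ge0// ltW.
  exists k; rewrite invf_plt ?posrE ?divr_gt0//; apply: (lt_le_trans Hk).
  by rewrite ler_nat.
have H j : exists q : rat, `|x 0 j - ratr q| < k.+1%:R^-1.
  have lt : x 0 j - k.+1%:R^-1 < x 0 j + k.+1%:R^-1.
    by rewrite ltrBlDr -addrA ltrDl addr_gt0// invr_gt0.
  have [q] := rat_in_itvoo lt.
  rewrite in_itv/= => /andP[h1 h2]; exists q.
  by rewrite ltr_distl ltrBlDr h2 -ltrBlDr h1.
have /choice [q qP] := H.
exists (\row_j q j, k).
  by move=> j; rewrite !mxE /=; exact: qP.
move=> y hy j; have := hy j; rewrite !mxE /= => hj.
have h := qP j.
apply: (le_lt_trans (ler_distD (ratr (q j)) _ _)).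
rewrite (splitr r) ltrD//; first exact: lt_trans hj kr.
by rewrite distrC; exact: lt_trans h kr.
Qed.

Lemma lsc_env_ge f x r (s : R) : 0 < r -> (forall y, cube x r y -> s <= f y) ->
  (s%:E <= lsc_env f x)%E.
Proof.
move=> r0 h; have [i ix ir] := ratcube_nbhs x r0.
rewrite lsc_envE; apply: (@le_trans _ _ (bump f (pickle i) x)); last first.
  by apply: ereal_sup_ubound; exists (pickle i).
rewrite /bump pickleK asboolT//; apply: le_ereal_inf_tmp => _ [y iy <-].
by rewrite lee_fin; apply: h; exact: ir.
Qed.

Lemma cube_shrink (c : 'rV[R]_n) r x : cube c r x ->
  exists2 p, 0 < p & cube x p `<=` cube c r.
Proof.
move=> xc.
have [p p0 ph] : exists2 p, 0 < p & forall j, p <= r - `|x 0 j - c 0 j|.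
  exists (\big[Num.min/1]_j (r - `|x 0 j - c 0 j|)).
    by apply: lt_bigmin => // j _; rewrite subr_gt0; exact: xc.
  by move=> j; apply: bigmin_le_cond.
exists p => // y yx j.
apply: (le_lt_trans (ler_distD (x 0 j) _ _)).
have := yx j; have := ph j => h1 h2; lra.
Qed.

Lemma lsc_env_gt f x (s : R) : 0 <= s -> (s%:E < lsc_env f x)%E ->
  exists2 r, 0 < r & forall y, cube x r y -> s <= f y.
Proof.
move=> s0; rewrite lsc_envE => /ereal_sup_gt[_ [k _ <-]].
rewrite /bump; case: unpickle => [i|]; last by rewrite lte_fin ltNge s0.
case: ifPn => [/asboolP ix|_]; last by rewrite lte_fin ltNge s0.
move=> h; have [r r0 rc] := cube_shrink ix.
exists r => // y yc; rewrite -lee_fin; apply/ltW; apply: (lt_le_trans h).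
by apply: ereal_inf_lbound; exists y => //; exact: rc.
Qed.

Lemma borel_lsc_env f : borel_fun (lsc_env f).
Proof.
move=> d T c mc; apply: (measurable_fun_esups (f := fun k t => bump f k (c t))) => k.
rewrite /bump; case: unpickle => [i|]; last exact: measurable_cst.
apply: measurable_fun_ifT => //.
apply: (measurable_fun_bool true).
have -> : (fun t => `[< ratcube i (c t) >]) @^-1` [set true] =
    \bigcap_(j in [set: 'I_n])
      [set t | `|c t 0 j - (\row_j ratr (i.1 0 j)) 0 j| < i.2.+1%:R^-1].
  apply/seteqP; split => t /=.
    by move=> /asboolP h j _; exact: h.
  by move=> h; apply/asboolP => j; exact: h.
rewrite setTI; apply: fin_bigcap_measurable; first exact: finite_finset.
move=> j _.
rewrite -[X in measurable X]setTI.
apply: (measurable_fun_ltr (f := fun t => `|c t 0 j - (\row_j ratr (i.1 0 j)) 0 j|)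
  (g := fun=> i.2.+1%:R^-1) _ _ measurableT (Y := [set true])) => //.
apply: measurableT_comp => //; exact: measurable_funB.
Qed.

(** A point [z] near [m = l x + (1 - l) y] is the same combination of [x + (z - m)] and
    [y + (z - m)], so lower bounds of [f] near [x] and [y] combine to one near [m]. The factor
    [t < 1] makes these bounds valid on cubes. *)
Lemma log_concave_lsc_env f : log_concave_fun f -> log_concave_ext (lsc_env f).
Proof.
move=> [f0 fc] x y l a b l01 a0 b0 ax by_.
apply/lee_mul01Pr; first by rewrite lee_fin mulr_ge0 ?powR_ge0.
move=> t /andP[t0 t1].
have [r r0 hr] : exists2 r, 0 < r & forall y, cube x r y -> t * a <= f y.
  apply: lsc_env_gt; first by rewrite mulr_ge0 ?ltW.
  by apply: lt_le_trans ax; rewrite lte_fin gtr_pMl.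
have [q q0 hq] : exists2 r, 0 < r & forall z, cube y r z -> t * b <= f z.
  apply: lsc_env_gt; first by rewrite mulr_ge0 ?ltW.
  by apply: lt_le_trans by_; rewrite lte_fin gtr_pMl.
rewrite -EFinM; apply: (@lsc_env_ge _ _ (Num.min r q)); first by rewrite lt_min r0.
set m := l *: x + _ => z zm.
have -> : z = l *: (x + (z - m)) + (1 - l) *: (y + (z - m)).
  have -> : l *: (x + (z - m)) + (1 - l) *: (y + (z - m)) = m + (z - m).
    rewrite !scalerDr addrACA -/m; congr (_ + _).
    by rewrite -!scalerDr -scalerDl addrC subrK scale1r.
  by rewrite addrC subrK.
apply: le_trans (fc _ _ _ l01).
have -> : t * (a `^ l * b `^ (1 - l)) = (t * a) `^ l * (t * b) `^ (1 - l).
  by rewrite !powRM ?(ltW t0) ?(ltW a0) ?(ltW b0)// mulrACA powR_onem.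
have l0 : 0 <= l by case/andP: l01 => /ltW.
have l1 : 0 <= 1 - l by rewrite subr_ge0; case/andP: l01 => _ /ltW.
have cubeD u p : Num.min r q <= p -> cube u p (u + (z - m)).
  move=> h j; have := zm j; rewrite !mxE => hj; apply: lt_le_trans h.
  by rewrite addrAC subrr add0r.
apply: ler_pM; rewrite ?powR_ge0//.
- apply: ge0_ler_powR => //; rewrite ?nnegrE ?mulr_ge0 ?(ltW t0) ?(ltW a0)//.
  by apply: hr; apply: cubeD; rewrite ge_min lexx.
- apply: ge0_ler_powR => //; rewrite ?nnegrE ?mulr_ge0 ?(ltW t0) ?(ltW b0)//.
  by apply: hq; apply: cubeD; rewrite ge_min lexx orbT.
Qed.

Lemma log_concave_superlevel f (s : R) : log_concave_fun f -> convex_subset [set x | s < f x].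
Proof.
move=> [f0 fc] x y l l01 /= sx sy.
have [s0|s0] := ltP s 0; first exact: lt_le_trans (f0 _).
apply: lt_le_trans (fc _ _ _ l01).
set m := Num.min (f x) (f y).
have sm : s < m by rewrite lt_min sx.
have m0 : 0 < m by apply: le_lt_trans sm.
have l0 : 0 <= l by case/andP: l01 => /ltW.
have l1 : 0 <= 1 - l by rewrite subr_ge0; case/andP: l01 => _ /ltW.
apply: (lt_le_trans sm); rewrite -{1}(powR_onem l m0).
apply: ler_pM; rewrite ?powR_ge0//; apply: ge0_ler_powR => //;
  by rewrite ?nnegrE ?(ltW m0)// ge_min lexx ?orbT.
Qed.

(* A log-concave function need not be Borel, but it differs from its lower
   semicontinuous envelope only on boundaries of its superlevel sets. *)
Lemma borel_version f : log_concave_fun f ->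
  exists g : 'rV[R]_n -> R, [/\ forall x, 0 <= g x <= f x,
    log_concave_ext (fun x => (g x)%:E), borel_fun (fun x => (g x)%:E) &
    forall Phi : 'rV[R]_n -> R -> \bar R,
      iint (fun x => Phi x (f x)) = iint (fun x => Phi x (g x))].
Proof.
move=> fc; have [f0 _] := fc.
have fin x : lsc_env f x \is a fin_num.
  rewrite ge0_fin_numE ?lsc_env_ge0//; apply: le_lt_trans (lsc_env_le x f0) _.
  by rewrite ltry.
exists (fun x => fine (lsc_env f x)).
have E : (fun x => (fine (lsc_env f x))%:E) = lsc_env f by apply/funext => x; rewrite fineK.
rewrite E; split; [|exact: log_concave_lsc_env|exact: borel_lsc_env|].
  by move=> x; rewrite -!lee_fin fineK// lsc_env_ge0// lsc_env_le.
move=> Phi.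
(* If the envelope is below [f x], a rational [q] lies strictly between, and [x] belongs to the
   convex set [{f > q}] but not to its interior. *)
pose K (k : nat) : set 'rV[R]_n := if unpickle k is Some q then [set x | ratr (q : rat) < f x] else set0.
apply: (@iint_eq_off_boundary _ _ K).
  move=> k; rewrite /K; case: unpickle => [q|//]; exact: log_concave_superlevel.
move=> x hx; congr Phi; apply/eqP; rewrite eq_le -!lee_fin fineK// lsc_env_le// andbT.
rewrite leNgt; apply/negP => h.
have h' : fine (lsc_env f x) < f x by rewrite -lte_fin fineK.
have [q] := rat_in_itvoo h'; rewrite in_itv/= => /andP[h1 h2].
have := hx (pickle q); rewrite /K pickleK => /(_ h2) [r r0 hr].
have : ((ratr q)%:E <= lsc_env f x)%E by apply: (lsc_env_ge r0) => y /hr /ltW.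
by rewrite -(fineK (fin x)) lee_fin leNgt h1.
Qed.

End regularization.

(** * Moments of log-concave functions *)

Section moments.
Variable R : realType.

Lemma integral_exp_norm_lty (r t0 : R) : 0 < r ->
  (\int[lebesgue_measure]_t (expR (- (r * `|t - t0|)))%:E < +oo)%E.
Proof.
move=> r0.
have mp : measurable_fun setT (exponential_pdf r) by exact: measurable_exponential_pdf.
have p0 x : 0 <= exponential_pdf r x by rewrite exponential_pdf_ge0// ltW.
have mp1 : measurable_fun setT (fun t : R => (exponential_pdf r (1 * t + (- t0)))%:E).
  apply/measurable_EFinP; apply: measurableT_comp => //.
  by apply: measurable_funD => //; exact: measurable_funM.
have mpN : measurable_fun setT (fun t : R => (exponential_pdf r (- t))%:E).
  by apply/measurable_EFinP; apply: measurableT_comp.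
have mp2 : measurable_fun setT (fun t : R => (exponential_pdf r (- (1 * t + (- t0))))%:E).
  apply: (measurableT_comp mpN).
  by apply: measurable_funD => //; exact: measurable_funM.
apply: (@le_lt_trans _ _ (\int[lebesgue_measure]_t (r^-1%:E *
    ((exponential_pdf r (1 * t + (- t0)))%:E + (exponential_pdf r (- (1 * t + (- t0))))%:E)))%E).
  apply: le_integralT => t; first by rewrite lee_fin expR_ge0.
  rewrite -EFinD -EFinM lee_fin mul1r.
  have E s : 0 <= s -> expR (- (r * s)) = r^-1 * exponential_pdf r s.
    by move=> s0; rewrite exponential_pdfE// mulKf ?gt_eqF// mulNr.
  have [h|/ltW h] := leP 0 (t - t0).
    by rewrite ger0_norm// E// ler_pM2l ?invr_gt0// lerDl.
  by rewrite ler0_norm// E ?oppr_ge0// ler_pM2l ?invr_gt0// lerDr.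
rewrite ge0_integralZl_EFin//; last 3 first.
- by move=> x _; rewrite adde_ge0// lee_fin.
- exact: emeasurable_funD.
- by rewrite invr_ge0 ltW.
rewrite ge0_integralD//; [|by move=> x _; rewrite lee_fin..].
have I1 : (\int[lebesgue_measure]_x (exponential_pdf r x)%:E = 1)%E.
  exact: integral_exponential_pdf.
have := integral_affine (- t0) (@ltr01 R) (f := fun t => (exponential_pdf r t)%:E).
rewrite mul1e => <-//; last by exact/measurable_EFinP.
have := integral_affine (- t0) (@ltr01 R) (f := fun t => (exponential_pdf r (- t))%:E).
rewrite mul1e => <-//; last by move=> x; rewrite lee_fin.
have := integral_opp (f := fun t => (exponential_pdf r t)%:E).
move=> <-//; last by exact/measurable_EFinP.
by rewrite I1 -!EFinD -EFinM ltry.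
Qed.

Lemma sqr_le_expR (u : R) : 0 <= u -> u ^+ 2 <= 4 * expR u.
Proof.
move=> u0; have h := expR_ge1Dx (u / 2).
have -> : expR u = expR (u / 2) ^+ 2 by rewrite expr2 -expRD -splitr.
have : u / 2 <= expR (u / 2) by lra.
move=> h'; have : (u / 2) ^+ 2 <= expR (u / 2) ^+ 2.
  by rewrite ler_sqr ?nnegrE ?expR_ge0// divr_ge0.
by rewrite expr_div_n; lra.
Qed.

(** If [g t0 >= c > 0], the interval [{g >= c / e}] has finite length, and [N] exceeds it; so
    [g < c / e] at distance [N] from [t0]. That point lies between [t0] and any farther [t], and
    log-concavity forces [g t <= c e^(-|t - t0| / N)]. *)
Lemma log_concave_exp_decay (g : R -> \bar R) : log_concave_ext (g : R^o -> \bar R) ->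
  measurable_fun setT g -> (forall t, 0 <= g t)%E ->
  (\int[lebesgue_measure]_t g t < +oo)%E ->
  exists t0 N c : R, [/\ 0 < N, 0 < c & forall t, N < `|t - t0| ->
    (g t <= (c * expR (- (`|t - t0| / N)))%:E)%E].
Proof.
move=> cg mg g0 gfin.
have [[t0 [c c0 ct0]]|H] := pselect (exists t0, exists2 c : R, 0 < c & (c%:E <= g t0)%E); last first.
  exists 0, 1, 1; split => // t _; rewrite (_ : g t = 0%E) ?lee_fin ?mul1r ?expR_ge0//.
  apply/eqP; rewrite eq_le g0 andbT leNgt; apply/negP => gt0; apply: H; exists t.
  case: (g t) gt0 => [r| |]//; rewrite ?lte_fin => r0; first by exists r.
  by exists 1 => //; rewrite leey.
pose e1 : R := expR (- 1).
have e10 : 0 < e1 by exact: expR_gt0.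
pose I := [set t | ((c * e1)%:E <= g t)%E].
have ce0 : 0 < c * e1 by rewrite mulr_gt0.
have cI : convex_subset (I : set R^o) by apply: (@log_concave_ext_superlevel R R^o g (c * e1)).
have It0 : I t0.
  by apply: le_trans ct0; rewrite lee_fin ler_piMr ?(ltW c0)// /e1 expR_le1 lerN10.
have mI : measurable I.
  by rewrite /I -[X in measurable X]setTI; exact: emeasurable_fun_c_infty.
have muI : ((c * e1)%:E * lebesgue_measure I <= \int[lebesgue_measure]_t g t)%E.
  rewrite -[I]setIT -integral_indic// -ge0_integralZl_EFin//; last 2 first.
    by apply/measurable_EFinP; exact: measurable_indic.
    exact: ltW.
  apply: le_integralT => t; first by rewrite mule_ge0// lee_fin// ltW.
  rewrite indicE; have [It|_] := boolP (t \in I); last by rewrite mule0.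
  by rewrite mule1; exact: set_mem It.
have muIfin : lebesgue_measure I \is a fin_num.
  rewrite ge0_fin_numE//; have := le_lt_trans muI gfin.
  have [->|//] := eqVneq (lebesgue_measure I) +oo%E; last by rewrite ltey.
  by rewrite gt0_muley ?lte_fin.
pose N := fine (lebesgue_measure I) + 1.
have N0 : 0 < N by rewrite ltr_wpDl// fine_ge0.
have notI s : `|s| = N -> ~ I (t0 + s).
  move=> sN Is.
  have : (lebesgue_measure `[Num.min t0 (t0 + s)%R, Num.max t0 (t0 + s)%R]%classic <= lebesgue_measure I)%E.
    apply: le_measure; rewrite ?inE// => z /=; rewrite in_itv/=.
    case: (leP t0 (t0 + s)) => _ zz; first exact: (convexS_itv cI It0 Is).
    exact: (convexS_itv cI Is It0).
  rewrite lebesgue_measure_itv/= lte_fin -(fineK muIfin).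
  have mm : Num.max t0 (t0 + s) - Num.min t0 (t0 + s) = N.
    rewrite -sN; case: (leP t0 (t0 + s)) => h.
      rewrite addrAC subrr add0r ger0_norm//; lra.
    rewrite ltr0_norm; lra.
  rewrite -subr_gt0 mm N0 -EFinB mm lee_fin /N; lra.
exists t0, N, c; split => // t tN.
set s := `|t - t0| in tN *.
have s0 : 0 < s by apply: lt_trans tN.
have sd : 0 < N / s < 1 by rewrite divr_gt0//= ltr_pdivrMr// mul1r.
suff bound b : 0 < b -> (b%:E <= g t)%E -> b <= c * expR (- (s / N)).
  case: (g t) (g0 t) bound => [r r0 bound| _ bound|//].
    rewrite lee_fin; move: r0; rewrite lee_fin le_eqVlt => /predU1P[<-|r0].
      by rewrite mulr_ge0 ?expR_ge0 ?ltW.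
    by apply: bound.
  have := bound (c * expR (- (s / N)) + 1).
  rewrite leey ltr_wpDl ?mulr_ge0 ?expR_ge0 ?(ltW c0)// => /(_ isT isT).
  by rewrite gerDl ler10.
move=> b0 bt; rewrite leNgt; apply/negP => cb.
have := cg t t0 (N / s) b c sd b0 c0 bt ct0.
have -> : (N / s) *: (t : R^o) + (1 - N / s) *: (t0 : R^o) = t0 + (t - t0) * N / s.
  by rewrite /GRing.scale /=; field; rewrite gt_eqF.
apply/negP; rewrite -ltNge.
have nI : ~ I (t0 + (t - t0) * N / s).
  apply: notI; rewrite normrM normfV normrM -/s [`|s|]gtr0_norm// (gtr0_norm N0).
  by rewrite mulrAC divff ?mul1r// gt_eqF.
move: nI => /negP; rewrite -ltNge => h; apply: (lt_le_trans h); rewrite lee_fin.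
have <- : (c * expR (- (s / N))) `^ (N / s) * c `^ (1 - N / s) = c * e1.
  rewrite powRM ?expR_ge0 ?(ltW c0)// mulrAC powR_onem// /powR gt_eqF ?expR_gt0//.
  rewrite expRK; congr (_ * expR _).
  by field; rewrite !gt_eqF.
rewrite ler_pM2r ?powR_gt0//; apply: ge0_ler_powR; rewrite ?nnegrE ?(ltW cb) ?(ltW b0)//.
- by case/andP: sd => /ltW.
- by rewrite mulr_ge0 ?expR_ge0 ?(ltW c0).
Qed.

Lemma log_concave_second_moment_line (g : R -> \bar R) : log_concave_ext (g : R^o -> \bar R) ->
  measurable_fun setT g -> (forall t, 0 <= g t)%E ->
  (\int[lebesgue_measure]_t g t < +oo)%E ->
  (\int[lebesgue_measure]_t ((t ^+ 2)%:E * g t) < +oo)%E.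
Proof.
move=> cg mg g0 gfin.
have [t0 [N [c [N0 c0 H]]]] := log_concave_exp_decay cg mg g0 gfin.
(* [K1] bounds [t^2] within distance [N] of [t0]. Farther away, half of the exponent absorbs
   [t^2 <= 2 t0^2 + 2 s^2], and [s^2 e^(-s / (2 N)) <= 16 N^2]. *)
pose K1 := (`|t0| + N) ^+ 2; pose K2 := c * (2 * t0 ^+ 2 + 32 * N ^+ 2).
pose r := (2 * N)^-1.
have r0 : 0 < r by rewrite invr_gt0 mulr_gt0.
have K10 : 0 <= K1 by exact: sqr_ge0.
have K20 : 0 <= K2 by rewrite mulr_ge0 ?(ltW c0)// addr_ge0// mulr_ge0// sqr_ge0.
have mE : measurable_fun setT (fun t : R => (expR (- (r * `|t - t0|)))%:E).
  apply/measurable_EFinP; apply: measurableT_comp => //.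
  apply: measurableT_comp => //; apply: measurable_funM => //.
  by apply: measurableT_comp => //; exact: measurable_funB.
apply: (@le_lt_trans _ _ (\int[lebesgue_measure]_t (K1%:E * g t +
    K2%:E * (expR (- (r * `|t - t0|)))%:E))%E).
  apply: le_integralT => t; first by rewrite mule_ge0// lee_fin sqr_ge0.
  have e0 : (0 <= K2%:E * (expR (- (r * `|t - t0|)))%:E)%E.
    by rewrite mule_ge0 ?lee_fin ?expR_ge0.
  have [tN|tN] := leP `|t - t0| N.
    apply: (@le_trans _ _ (K1%:E * g t)%E); last by rewrite leeDl.
    rewrite lee_wpmul2r// lee_fin /K1 -(@real_normK _ t) ?num_real//.
    rewrite ler_sqr ?nnegrE ?addr_ge0// ?(ltW N0)//.
    have := ler_normD (t - t0) t0; rewrite subrK; lra.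
  apply: (@le_trans _ _ (K2%:E * (expR (- (r * `|t - t0|)))%:E)%E); last first.
    by rewrite leeDr// mule_ge0.
  apply: (@le_trans _ _ ((t ^+ 2)%:E * (c * expR (- (`|t - t0| / N)))%:E)%E).
    by apply: lee_wpmul2l; [rewrite lee_fin sqr_ge0|exact: H].
  rewrite -!EFinM lee_fin /K2.
  set s := `|t - t0|; have s0 : 0 <= s by exact: normr_ge0.
  have -> : expR (- (s / N)) = expR (- (r * s)) * expR (- (r * s)).
    by rewrite -expRD; congr expR; rewrite /r; field; rewrite gt_eqF.
  have ts : t ^+ 2 <= 2 * t0 ^+ 2 + 2 * s ^+ 2.
    rewrite /s real_normK ?num_real//.
    by have := sqr_ge0 (t - 2 * t0); nra.
  have half_space := sqr_le_expR (mulr_ge0 (ltW r0) s0).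
  set E := expR (- (r * s)).
  have E1 : E <= 1 by rewrite /E expR_le1 oppr_le0 mulr_ge0// ltW.
  have E0 : 0 < E by exact: expR_gt0.
  have sE : s ^+ 2 * E <= 16 * N ^+ 2.
    have -> : s ^+ 2 = 4 * N ^+ 2 * (r * s) ^+ 2.
      by rewrite /r; field; rewrite gt_eqF.
    have : (r * s) ^+ 2 * E <= 4.
      by apply: le_trans (ler_wpM2r (ltW E0) half_space) _; rewrite -mulrA /E expRN mulfV ?mulr1// gt_eqF ?expR_gt0.
    move=> h; have N2 : 0 <= 4 * N ^+ 2 by rewrite mulr_ge0// sqr_ge0.
    by have := ler_wpM2l N2 h; rewrite mulrA; lra.
  have tE : t ^+ 2 * E <= 2 * t0 ^+ 2 + 32 * N ^+ 2.
    have h1 : t ^+ 2 * E <= (2 * t0 ^+ 2 + 2 * s ^+ 2) * E by rewrite ler_pM2r.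
    have h2 : t0 ^+ 2 * E <= t0 ^+ 2 by rewrite ler_piMr// sqr_ge0.
    have h3 : (2 * t0 ^+ 2 + 2 * s ^+ 2) * E = 2 * (t0 ^+ 2 * E) + 2 * (s ^+ 2 * E).
      by ring.
    by rewrite h3 in h1; lra.
  have -> : t ^+ 2 * (c * (E * E)) = c * (t ^+ 2 * E) * E by ring.
  by rewrite ler_pM2r// ler_pM2l.
rewrite ge0_integralD//; last 4 first.
- by move=> x _; rewrite mule_ge0.
- exact: measurable_funeM.
- by move=> x _; rewrite mule_ge0// lee_fin expR_ge0.
- exact: measurable_funeM.
rewrite !ge0_integralZl_EFin//.
rewrite lte_add_pinfty// lte_mul_pinfty//.
exact: integral_exp_norm_lty.
Qed.

(** Finite second moments are not part of the definitions. They reduce to the line because marginals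
    are log-concave: integrate out coordinate 0 if [i] is another one, and all the others if [i] is
    0. *)
Lemma log_concave_second_moment n (F : 'rV[R]_n -> \bar R) i : log_concave_ext F -> borel_fun F ->
  (forall x, 0 <= F x)%E -> (iint F < +oo)%E ->
  (iint (fun x => ((x 0 i ^+ 2)%:E * F x)) < +oo)%E.
Proof.
elim: n F i => [|n IH] F i cF mF F0 Ffin; first by case: i.
have mF2 (j : 'I_n.+1) : borel_fun (fun x : 'rV[R]_n.+1 => ((x 0 j ^+ 2)%:E * F x)%E).
  move=> d T c mc; apply: emeasurable_funM; last exact: mF.
  by apply/measurable_EFinP; apply: measurable_funX; exact: mc.
have F20 (j : 'I_n.+1) (x : 'rV[R]_n.+1) : (0 <= (x 0 j ^+ 2)%:E * F x)%E.
  by rewrite mule_ge0// lee_fin sqr_ge0.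
have cF' : log_concave_ext (fun w : R^o * 'rV[R]_n => F (row_mx (const_mx w.1 : 'rV_1) w.2)).
  move=> [s x] [t y] l a b l01 a0 b0 /= ax by_.
  by have := cF _ _ l a b l01 a0 b0 ax by_; rewrite row_mx_comb.
have [j ->|->] := unliftP (0 : 'I_n.+1) i.
  rewrite /=.
  under eq_integral do under eq_fun do rewrite row_mx_lift.
  rewrite (iint_integral_swap (G := fun t (y : 'rV[R]_n) => ((y 0 j ^+ 2)%:E *
     F (row_mx (const_mx t : 'rV_1) y))%E)); last 2 first.
  - move=> d T u c mu mc; apply: emeasurable_funM.
      by apply/measurable_EFinP; apply: measurable_funX; exact: mc.
    exact: (borel_param_slice mF).
  - by move=> t x; rewrite mule_ge0// lee_fin sqr_ge0.
  have ms y : measurable_fun setT (fun t : measurableTypeR R => F (row_mx (const_mx t : 'rV_1) y)).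
    by apply: (borel_param_slice mF (u := id) (c := fun=> y)) => //; exact: measurable_row_cst.
  under eq_iint do rewrite ge0_integralZl_EFin ?sqr_ge0//.
  apply: IH.
  - apply: (log_concave_integral (G := fun y t => F (row_mx (const_mx t : 'rV_1) y))) => //.
    move=> [x s] [y t] l a b l01 a0 b0 /= ax by_.
    exact: (cF' (s, x) (t, y) l a b l01 a0 b0 ax by_).
  - move=> d T c mc.
    apply: (@measurable_fun_fubini_tonelli_F _ _ _ _ _ (@lebesgue_measure R)
      (fun tw : T * measurableTypeR R => F (row_mx (const_mx tw.2 : 'rV_1) (c tw.1)))) => //.
    by apply: (borel_param_slice mF (u := snd) (c := c \o fst)) => //; exact: measurable_row_comp.
  - by move=> x; exact: integral_ge0.
  - rewrite -(iint_integral_swap (G := fun t y => F (row_mx (const_mx t : 'rV_1) y)))//.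
    exact: borel_param_slice.
rewrite /=; under eq_integral do under eq_fun do rewrite row_mx_head.
under eq_integral => t _.
  rewrite iintZ ?sqr_ge0//; last exact: borel_slice.
  over.
apply: log_concave_second_moment_line.
- apply: (@log_concave_iint _ _ R^o (fun t y => F (row_mx (const_mx t : 'rV_1) y))) => // u.
  exact: borel_slice.
- exact: measurable_slice.
- by move=> t; exact: iint_ge0.
- exact: Ffin.
Qed.

End moments.

(** * Separation of a point from an algebraically open convex set *)

Section separation.
Variable R : realType.

Lemma dotvDr n (u v w : 'rV[R]_n) : dotv u (v + w) = dotv u v + dotv u w.
Proof. by rewrite /dotv -big_split; apply: eq_bigr => i _; rewrite mxE mulrDr. Qed.

Lemma dotvZr n a (u v : 'rV[R]_n) : dotv u (a *: v) = a * dotv u v.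
Proof. by rewrite /dotv mulr_sumr; apply: eq_bigr => i _; rewrite mxE mulrCA. Qed.

Lemma dotv_row_mx n (s t : R) (u v : 'rV[R]_n) :
  dotv (row_mx (const_mx s : 'rV_1) u : 'rV_n.+1) (row_mx (const_mx t : 'rV_1) v) =
  s * t + dotv u v.
Proof.
rewrite /dotv big_ord_recl !row_mx_head; congr (_ + _).
by apply: eq_bigr => i _; rewrite !row_mx_lift.
Qed.

Lemma dotv_eq0 n (u : 'rV[R]_n) : dotv u u = 0 -> u = 0.
Proof.
move=> /eqP; rewrite /dotv psumr_eq0; last by move=> i _; rewrite -expr2 sqr_ge0.
move=> /allP h; apply/rowP => i; rewrite mxE.
by have := h i (mem_index_enum _); rewrite /= -expr2 sqrf_eq0 => /eqP.
Qed.

Lemma dotv_ge0 n (u : 'rV[R]_n) : 0 <= dotv u u.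
Proof. by apply: sumr_ge0 => i _; rewrite -expr2 sqr_ge0. Qed.

(** Openness along lines only, which log-concavity supplies without any continuity argument. *)
Definition algebraic_open (V : lmodType R) (C : set V) :=
  forall y v, C y -> exists2 e : R, 0 < e & C (y + e *: v).

(* The Hahn-Banach extension step, one coordinate at a time. *)
Lemma separation_origin n (C : set 'rV[R]_n) : convex_subset C -> algebraic_open C -> ~ C 0 ->
  exists th : 'rV[R]_n, forall y, C y -> 0 < dotv th y.
Proof.
elim: n C => [|n IH] C cC oC C0.
  exists 0 => y Cy; exfalso; apply: C0; rewrite (_ : 0 = y)//.
  by apply/rowP => -[].
pose D := [set y : 'rV[R]_n | C (row_mx (const_mx 0 : 'rV_1) y)].
have cD : convex_subset D.
  move=> x y l l01 Dx Dy; have := cC _ _ l l01 Dx Dy.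
  by rewrite row_mx_comb !mulr0 addr0.
have zE : row_mx (const_mx 0 : 'rV_1) (0 : 'rV[R]_n) = 0 :> 'rV[R]_n.+1.
  by apply/rowP => i; case: (unliftP 0 i) => [j ->|->];
    rewrite ?row_mx_lift ?row_mx_head !mxE.
have oD : algebraic_open D.
  move=> y v Dy; have [e e0 h] := oC _ (row_mx (const_mx 0 : 'rV_1) v) Dy.
  exists e => //; move: h; rewrite -[X in X + _](scale1r) row_mx_comb.
  by rewrite !mulr0 addr0 scale1r.
have [|eta etaP] := IH D cD oD; first by rewrite /D /= zE.
have mid t y s w : 0 < t -> 0 < s -> C (row_mx (const_mx t : 'rV_1) y) ->
    C (row_mx (const_mx (- s) : 'rV_1) w) ->
    D ((t + s)^-1 *: (s *: y + t *: w)).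
  move=> t0 s0 Ct Cs; have ts : 0 < t + s by rewrite addr_gt0.
  have := cC _ _ (s / (t + s)) _ Ct Cs; rewrite row_mx_comb /D /=.
  have l01 : 0 < s / (t + s) < 1.
    by rewrite divr_gt0//= ltr_pdivrMr// mul1r ltrDr.
  move=> /(_ l01).
  have -> : s / (t + s) * t + (1 - s / (t + s)) * - s = 0 by field; rewrite gt_eqF.
  have -> : 1 - s / (t + s) = t / (t + s) by field; rewrite gt_eqF.
  by rewrite scalerDr !scalerA ![_^-1 * _]mulrC.
(* If [C] misses the hyperplane where the first coordinate is 0, it lies on one side of it, and that
   coordinate up to sign separates. *)
have [[y0 Dy0]|noD] := pselect (exists y, D y); last first.
  have sgn (a : R) : (forall t y, C (row_mx (const_mx t : 'rV_1) y) -> 0 < a * t) ->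
      exists th : 'rV[R]_n.+1, forall y, C y -> 0 < dotv th y.
    move=> h; exists (row_mx (const_mx a : 'rV_1) 0) => y Cy.
    rewrite (row_mx_split y) dotv_row_mx (_ : dotv 0 _ = 0) ?addr0.
      by apply: (h _ (rsubmx (y : 'rV_(1 + n)))); rewrite -row_mx_split.
    by rewrite /dotv big1// => i _; rewrite mxE mul0r.
  have nz t y : C (row_mx (const_mx t : 'rV_1) y) -> t != 0.
    by move=> Ct; apply/eqP => t0; apply: noD; exists y; rewrite /D /= -t0.
  have [[t [y [Ct t0]]]|H] := pselect (exists t y, C (row_mx (const_mx t : 'rV_1) y) /\ 0 < t).
    apply: (sgn 1) => s w Cs; rewrite mul1r lt_neqAle eq_sym (nz _ _ Cs) /= leNgt.
    apply/negP => s0; apply: noD.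
    exists ((t + - s)^-1 *: ((- s) *: y + t *: w)); apply: mid; rewrite ?oppr_gt0 ?opprK//.
  apply: (sgn (-1)) => t y Ct; rewrite mulN1r oppr_gt0 lt_neqAle (nz _ _ Ct) /= leNgt.
  by apply/negP => t0; apply: H; exists t, y.
have shift v t e : y0 + e *: (0 : 'rV[R]_n) = y0 -> C (row_mx (const_mx 0 : 'rV_1) y0 + e *: row_mx (const_mx t : 'rV_1) (v : 'rV[R]_n)) ->
    C (row_mx (const_mx (e * t) : 'rV_1) (y0 + e *: v)).
  by move=> _; rewrite -[X in X + _]scale1r row_mx_comb scale1r mulr0 add0r.
have e0y e : y0 + e *: (0 : 'rV[R]_n) = y0 by rewrite scaler0 addr0.
have [e1 e10 /(shift _ _ _ (e0y _))] := oC _ (row_mx (const_mx 1 : 'rV_1) 0) Dy0.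
rewrite e0y mulr1 => C1.
have [e2 e20 /(shift _ _ _ (e0y _))] := oC _ (row_mx (const_mx (-1) : 'rV_1) 0) Dy0.
rewrite e0y mulrN1 => C2.
(* The new coefficient must be at least every element of [A] (points with [t > 0]) and at most every
   [dotv eta w / s] (points with first coordinate [- s < 0]); [mid] makes the two families
   compatible. *)
pose A := [set a | exists t y, [/\ C (row_mx (const_mx t : 'rV_1) y), 0 < t & a = - dotv eta y / t]].
have ubA s w : 0 < s -> C (row_mx (const_mx (- s) : 'rV_1) w) -> ubound A (dotv eta w / s).
  move=> s0 Cs _ [t [y [Ct t0 ->]]].
  have := etaP _ (mid _ _ _ _ t0 s0 Ct Cs).
  rewrite dotvZr pmulr_rgt0 ?invr_gt0 ?addr_gt0// dotvDr !dotvZr => h.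
  by rewrite ler_pdivrMr// mulrAC ler_pdivlMr//; nra.
have A0 : A !=set0 by exists (- dotv eta y0 / e1), e1, y0.
have hsA : has_sup A by split => //; exists (dotv eta y0 / e2); exact: ubA.
pose th : 'rV[R]_n.+1 := row_mx (const_mx (sup A) : 'rV_1) eta.
have thge y : C y -> 0 <= dotv th y.
  rewrite (row_mx_split y) dotv_row_mx; set t := y 0 0; set z := rsubmx _ => Cy.
  have [t0|t0|t0] := ltgtP t 0.
  - have st : sup A <= dotv eta z / (- t).
      by apply: ge_sup => //; apply: ubA; rewrite ?oppr_gt0 ?opprK.
    by move: st; rewrite ler_pdivlMr ?oppr_gt0//; lra.
  - have st : - dotv eta z / t <= sup A.
      by apply: ub_le_sup; [case: hsA|exists t, z].
    by move: st; rewrite ler_pdivrMr//; lra.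
  - by rewrite t0 mulr0 add0r; apply/ltW/etaP; move: Cy; rewrite t0.
(* Strictness: if the functional vanished at [y], a small move along [- th] would make it negative
   unless [th = 0], and this contradicts [eta] being positive on the nonempty [D]. *)
exists th => y Cy; rewrite lt_neqAle thge// andbT; apply/eqP => h0.
have [e ee h] := oC _ (- th) Cy.
have := thge _ h; rewrite dotvDr -h0 add0r dotvZr.
have -> : dotv th (- th) = - dotv th th by rewrite -scaleN1r dotvZr mulN1r.
rewrite mulrN oppr_ge0 pmulr_rle0// => th0.
have : dotv th th = 0 by apply/eqP; rewrite eq_le th0 dotv_ge0.
move/dotv_eq0 => thz; have := etaP _ Dy0.
have : dotv th (row_mx (const_mx 0 : 'rV_1) y0) = dotv eta y0.
  by rewrite dotv_row_mx mulr0 add0r.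
move=> <-; rewrite thz /dotv big1 ?ltxx// => i _.
by rewrite mxE mul0r.
Qed.

End separation.

(** * Gaussian integrals *)

Section gaussian.
Variable R : realType.

Definition quad_form n (A : 'M[R]_n) (x : 'rV[R]_n) : R := (x *m A *m x^T) 0 0.

Definition posdef n (A : 'M[R]_n) := A^T = A /\ forall x, x != 0 -> 0 < quad_form A x.

Lemma qfE n (A : 'M[R]_n) x : quad_form A x = \sum_i \sum_j A i j * (x 0 i * x 0 j).
Proof.
rewrite /quad_form !mxE exchange_big /=; apply: eq_bigr => j _.
rewrite !mxE mulr_suml; apply: eq_bigr => i _.
by rewrite mulrAC mulrC.
Qed.

Lemma qf0 n (A : 'M[R]_n) : quad_form A 0 = 0.
Proof. by rewrite /quad_form !mul0mx mxE. Qed.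

Lemma qf_scale n (A : 'M[R]_n) k x : quad_form (k *: A) x = k * quad_form A x.
Proof. by rewrite /quad_form -scalemxAr -scalemxAl mxE. Qed.

Lemma posdef_ge0 n (A : 'M[R]_n) x : posdef A -> 0 <= quad_form A x.
Proof.
move=> [_ h]; have [->|x0] := eqVneq x 0; first by rewrite qf0.
exact/ltW/h.
Qed.

Lemma measurable_qf n (A : 'M[R]_n) d (T : measurableType d) (c : T -> 'rV[R]_n) :
  measurable_row c -> measurable_fun setT (fun t => quad_form A (c t)).
Proof.
move=> mc; under eq_fun do rewrite qfE.
apply: measurable_sum => i; apply: measurable_sum => j.
by apply: measurable_funM => //; apply: measurable_funM; exact: mc.
Qed.

(** Completing the square in the last [n] coordinates; the coefficient left at [t^2] is the Schur
    complement. *)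
Lemma qf_schur n (A : 'M[R]_(1 + n)) (t : R) (y : 'rV[R]_n) : A^T = A ->
  drsubmx A \in unitmx ->
  let c := ursubmx A *m invmx (drsubmx A) in
  quad_form A (row_mx (const_mx t) y) =
  (ulsubmx A - c *m dlsubmx A) 0 0 * t ^+ 2 + quad_form (drsubmx A) (y + t *: c).
Proof.
move=> symA uB c.
have symB : (drsubmx A)^T = drsubmx A by rewrite trmx_drsub symA.
have symb : (ursubmx A)^T = dlsubmx A by rewrite trmx_ursub symA.
have symc : invmx (drsubmx A) *m dlsubmx A = c^T.
  by rewrite /c trmx_mul trmx_inv symB symb.
have tE : const_mx t = t%:M :> 'M[R]_1.
  by apply/matrixP => i j; rewrite !ord1 !mxE eqxx mulr1n.
rewrite /quad_form -{1}(submxK A) tE mul_row_block tr_row_mx mul_row_col.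
have -> : (y + t *: c) *m drsubmx A *m (y + t *: c)^T =
    y *m drsubmx A *m y^T + t *: (y *m drsubmx A *m c^T) +
    t *: (c *m drsubmx A *m y^T) + t ^+ 2 *: (c *m drsubmx A *m c^T).
  rewrite !mulmxDl linearD /= linearZ /= !mulmxDr -!scalemxAl -!scalemxAr.
  by rewrite scalerA -expr2 !addrA addrAC.
rewrite -symc !mulmxA mulmxK// /c mulmxKV//.
rewrite tr_scalar_mx !mulmxDl !mul_scalar_mx !mul_mx_scalar -!scalemxAl.
rewrite !mxE; ring.
Qed.

Lemma det_schur n (A : 'M[R]_(1 + n)) : drsubmx A \in unitmx ->
  let c := ursubmx A *m invmx (drsubmx A) in
  \det A = (ulsubmx A - c *m dlsubmx A) 0 0 * \det (drsubmx A).
Proof.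
move=> uB c.
pose U : 'M[R]_(1 + n) := block_mx 1%:M (- c) 0 1%:M.
have -> : \det A = \det (U *m A).
  by rewrite det_mulmx /U det_ublock !det1 !mul1r.
rewrite -{1}(submxK A) /U mulmx_block !mul1mx !mul0mx !add0r !mulNmx.
by rewrite /c mulmxKV// subrr det_lblock det_mx11.
Qed.

Lemma integral_gauss1 (s : R) : 0 < s ->
  (\int[lebesgue_measure]_t (expR (- (s * t ^+ 2) / 2))%:E =
   (Num.sqrt (2 * pi) / Num.sqrt s)%:E)%E.
Proof.
move=> s0; pose c := Num.sqrt (s / 2).
have c0 : 0 < c by rewrite sqrtr_gt0 divr_gt0.
have := @integral_affine R c 0 (fun t => (gauss_fun t)%:E) c0.
rewrite integralT_gauss.
have mg : measurable_fun setT (fun t : R => (gauss_fun t)%:E).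
  by apply/measurable_EFinP; exact: measurable_gauss_fun.
move=> /(_ mg (fun x => gauss_fun_ge0 x : (0 <= (gauss_fun x)%:E)%E)).
have -> : (\int[lebesgue_measure]_t (gauss_fun (c * t + 0))%:E =
    \int[lebesgue_measure]_t (expR (- (s * t ^+ 2) / 2))%:E)%E.
  apply: eq_integral => t _; rewrite /gauss_fun addr0 exprMn sqr_sqrtr ?divr_ge0 ?(ltW s0)//.
  by congr (expR _)%:E; field.
move=> H; rewrite -[LHS]mul1e.
have -> : (1 = c^-1%:E * c%:E)%E by rewrite -EFinM mulVf// gt_eqF.
rewrite -muleA -H -EFinM; congr (_%:E).
rewrite /c sqrtrM ?(ltW s0)// sqrtrM// sqrtrV//.
by field; rewrite !gt_eqF// sqrtr_gt0.
Qed.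

Lemma qf_row0 n (A : 'M[R]_(1 + n)) (y : 'rV[R]_n) :
  quad_form A (row_mx (0 : 'rV_1) y) = quad_form (drsubmx A) y.
Proof.
rewrite /quad_form -{1}(submxK A) mul_row_block tr_row_mx mul_row_col trmx0 mulmx0.
by rewrite !mul0mx !add0r.
Qed.

(** Once the square is completed, the inner integral is that of the block [B] up to a translation,
    and [det A] is the Schur complement times [det B]. *)
Lemma gaussian_integral n (A : 'M[R]_n) : posdef A ->
  0 < \det A /\
  iint (fun x => (expR (- quad_form A x / 2))%:E) =
    (Num.sqrt (2 * pi) ^+ n / Num.sqrt (\det A))%:E.
Proof.
elim: n A => [|n IH] A pA.
  by rewrite det_mx00 /= qf0 oppr0 mul0r expR0 expr0 sqrtr1 divr1.
pose B := drsubmx (A : 'M[R]_(1 + n)).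
pose c := ursubmx (A : 'M[R]_(1 + n)) *m invmx B.
pose s := (ulsubmx (A : 'M[R]_(1 + n)) - c *m dlsubmx (A : 'M[R]_(1 + n))) 0 0.
have [symA posA] := pA.
have symB : B^T = B by rewrite trmx_drsub symA.
have pB : posdef B.
  split=> // y y0.
  rewrite -qf_row0; apply: posA; apply: contra y0 => /eqP h.
  apply/eqP/rowP => i; have := congr1 (fun v : 'rV[R]_(1 + n) => v 0 (rshift 1 i)) h.
  by rewrite /= row_mxEr !mxE.
have [detB IHB] := IH B pB.
have uB : B \in unitmx by rewrite unitmxE unitfE gt_eqF.
have qfA t y : quad_form A (row_mx (const_mx t : 'rV_1) y) = s * t ^+ 2 + quad_form B (y + t *: c).
  exact: (@qf_schur n A t y symA uB).
(* The vector [(1, - c)] makes the completed square vanish, so the form takes the value [s]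
   there. *)
have s0 : 0 < s.
  have := posA (row_mx (const_mx 1 : 'rV_1) (- c)).
  rewrite qfA scale1r addNr qf0 addr0 expr1n mulr1; apply.
  apply/eqP => h; have := congr1 (fun v : 'rV[R]_n.+1 => v 0 0) h.
  by rewrite /= row_mx_head mxE => /eqP; rewrite oner_eq0.
have detA : \det A = s * \det B by exact: (@det_schur n A uB).
split; first by rewrite detA mulr_gt0.
rewrite /=.
have mBq (k : 'rV[R]_n) : borel_fun (fun y => (expR (- quad_form B (y + k) / 2))%:E).
  move=> d T v mv; apply/measurable_EFinP; apply: measurableT_comp => //.
  apply: measurable_funM => //; apply: measurableT_comp => //.
  by apply: measurable_qf; apply: measurable_rowD => //; exact: measurable_row_cst.
have mB : borel_fun (fun y => (expR (- quad_form B y / 2))%:E).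
  by have := mBq 0; under eq_fun do rewrite addr0.
pose G := Num.sqrt (2 * pi) ^+ n / Num.sqrt (\det B).
transitivity (\int[lebesgue_measure]_(t in [set: R])
    (G%:E * (expR (- (s * t ^+ 2) / 2))%:E))%E.
  apply: eq_integral => t _.
  transitivity (iint (fun y : 'rV[R]_n => (expR (- (s * t ^+ 2) / 2))%:E *
      (expR (- quad_form B (y + t *: c) / 2))%:E)%E).
    by apply: eq_iint => y; rewrite qfA opprD mulrDl expRD.
  rewrite (iintZ (mBq _) (expR_ge0 _)); last by move=> y; rewrite lee_fin expR_ge0.
  rewrite muleC; congr (_ * _)%E; rewrite -IHB.
  rewrite (iint_affine (t *: c) mB _ ltr01); last by move=> y; rewrite lee_fin expR_ge0.
  by rewrite expr1n mul1e; apply: eq_iint => y; rewrite scale1r.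
rewrite ge0_integralZl_EFin//; last 2 first.
- apply/measurable_EFinP; apply: measurableT_comp => //.
  apply: measurable_funM => //; apply: measurableT_comp => //.
  by apply: measurable_funM => //; exact: measurable_funX.
- by rewrite /G divr_ge0// exprn_ge0.
rewrite integral_gauss1// -EFinM; congr (_%:E).
rewrite /G detA (sqrtrM _ (ltW s0)) exprSr.
by field; rewrite !gt_eqF// sqrtr_gt0.
Qed.

End gaussian.

(** * Gaussian-smoothed sums of independent vectors *)

Section smoothed_sum.
Variable R : realType.
Variables (n : nat) (f : 'rV[R]_n -> R) (A : 'M[R]_n).
Hypothesis f0 : forall x, 0 <= f x.
Hypothesis cf : log_concave_ext (fun x => (f x)%:E).
Hypothesis mf : borel_fun (fun x => (f x)%:E).
Hypothesis f1 : iint (fun x => (f x)%:E) = 1%E.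
Hypothesis pA : posdef A.
Implicit Types (x y z th : 'rV[R]_n).

(* Up to a constant factor, [smooth k] is the density of [X_1 + ... + X_k + G],
   where the [X_i] are independent with density [f] and [G] is a centered
   Gaussian vector with covariance [A^-1]. *)
Fixpoint smooth (k : nat) (z : 'rV[R]_n) : \bar R :=
  if k is k'.+1 then iint (fun x => (f x)%:E * smooth k' (z - x)%R)%E
  else (expR (- quad_form A z / 2))%:E.

Lemma smooth_ge0 k z : (0 <= smooth k z)%E.
Proof.
elim: k z => [|k IH] z /=; first by rewrite lee_fin expR_ge0.
by apply: iint_ge0 => x; rewrite mule_ge0// lee_fin.
Qed.

Lemma smooth_le1 k z : (smooth k z <= 1)%E.
Proof.
elim: k z => [|k IH] z /=.
  by rewrite lee_fin expR_le1 mulNr oppr_le0 divr_ge0// posdef_ge0.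
rewrite -f1; apply: le_iint => x; first by rewrite mule_ge0 ?lee_fin// smooth_ge0.
by rewrite -[leRHS]mule1; apply: lee_wpmul2l; rewrite ?lee_fin.
Qed.

Lemma borel_smooth_shift k : borel_fun (smooth k) ->
  borel_fun2 (fun z x => (f x)%:E * smooth k (z - x)%R)%E.
Proof.
move=> mk d T u c mu mc; apply: emeasurable_funM; first exact: (mf mc).
by apply: mk; exact: measurable_rowB.
Qed.

Lemma borel_smooth k : borel_fun (smooth k).
Proof.
elim: k => [|k IH] /=.
  move=> d T c mc; apply/measurable_EFinP; apply: measurableT_comp => //.
  apply: measurable_funM => //; apply: measurableT_comp => //.
  exact: measurable_qf.
apply: borel_iint; first exact: borel_smooth_shift.
by move=> z x; rewrite mule_ge0 ?lee_fin// smooth_ge0.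
Qed.

Lemma smooth_fin k z : smooth k z \is a fin_num.
Proof.
rewrite ge0_fin_numE ?smooth_ge0//; apply: le_lt_trans (smooth_le1 k z) _.
by rewrite ltry.
Qed.

Definition rsmooth k z := fine (smooth k z).

Lemma smoothE k z : smooth k z = (rsmooth k z)%:E.
Proof. by rewrite fineK// smooth_fin. Qed.

Lemma qf_convex x y l : 0 < l < 1 ->
  quad_form A (l *: x + (1 - l) *: y) <= l * quad_form A x + (1 - l) * quad_form A y.
Proof.
move=> /andP[l0 l1].
have h := posdef_ge0 (x - y) pA.
have E : l * quad_form A x + (1 - l) * quad_form A y - quad_form A (l *: x + (1 - l) *: y) =
    l * (1 - l) * quad_form A (x - y).
  rewrite !qfE !mulr_sumr -big_split/= -sumrB; apply: eq_bigr => i _.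
  rewrite !mulr_sumr -big_split/= -sumrB; apply: eq_bigr => j _.
  by rewrite !mxE; ring.
by rewrite -subr_ge0 E mulr_ge0// mulr_ge0 ?subr_ge0 ?(ltW l0) ?(ltW l1).
Qed.

Lemma log_concave_smooth k : log_concave_ext (smooth k).
Proof.
elim: k => [|k IH] /=.
  move=> x y l a b l01 a0 b0; rewrite !lee_fin => ax by_.
  have l0 : 0 <= l by case/andP: l01 => /ltW.
  have l1 : 0 <= 1 - l by rewrite subr_ge0; case/andP: l01 => _ /ltW.
  apply: (@le_trans _ _ (expR (- quad_form A x / 2) `^ l * expR (- quad_form A y / 2) `^ (1 - l))).
    by apply: ler_pM; rewrite ?powR_ge0//; apply: ge0_ler_powR;
      rewrite ?nnegrE ?expR_ge0 ?(ltW a0) ?(ltW b0).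
  rewrite /powR !gt_eqF ?expR_gt0// !expRK -expRD ler_expR.
  by have := qf_convex x y l01; lra.
apply: (log_concave_iint (G := fun z x => (f x)%:E * smooth k (z - x)%R)%E).
- move=> [z x] [z' x'] l a b l01 a0 b0 /=.
  rewrite !smoothE -!EFinM !lee_fin => ha hb.
  have l0 : 0 <= l by case/andP: l01 => /ltW.
  have l1 : 0 <= 1 - l by rewrite subr_ge0; case/andP: l01 => _ /ltW.
  have pos u v c : 0 < c -> c <= f u * rsmooth k v -> 0 < f u /\ 0 < rsmooth k v.
    move=> c0 h; have h' : 0 < f u * rsmooth k v by apply: lt_le_trans h.
    have v0 : 0 <= rsmooth k v by rewrite fine_ge0// smooth_ge0.
    split; rewrite lt_neqAle ?f0 ?v0 andbT eq_sym; apply/eqP => z0; move: h';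
      by rewrite z0 ?mul0r ?mulr0 ltxx.
  have [fx px] := pos _ _ _ a0 ha; have [fx' px'] := pos _ _ _ b0 hb.
  have H1 := @cf x x' l _ _ l01 fx fx' (lexx _) (lexx _); rewrite lee_fin in H1.
  have H2 := IH (z - x) (z' - x') l _ _ l01 px px'; rewrite !smoothE !lee_fin in H2.
  have {}H2 := H2 (lexx _) (lexx _).
  have -> : l *: z + (1 - l) *: z' - (l *: x + (1 - l) *: x') =
      l *: (z - x) + (1 - l) *: (z' - x').
    by rewrite !scalerBr opprD addrACA.
  apply: le_trans (ler_pM _ _ H1 H2); rewrite ?mulr_ge0 ?powR_ge0//.
  rewrite mulrACA -!powRM ?(ltW fx) ?(ltW px) ?(ltW fx') ?(ltW px')//.
  by apply: ler_pM; rewrite ?powR_ge0//; apply: ge0_ler_powR;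
    rewrite ?nnegrE ?mulr_ge0 ?(ltW a0) ?(ltW b0) ?(ltW fx) ?(ltW px) ?(ltW fx') ?(ltW px').
- by move=> u; apply: (borel_fun2_section (G := fun z x => (f x)%:E * smooth k (z - x)%R)%E);
    exact: borel_smooth_shift (borel_smooth k).
- by move=> u x; rewrite mule_ge0 ?lee_fin// smooth_ge0.
Qed.

(** A zero integral would force [f h = 0], hence [f = 0], almost everywhere, against total mass
    1. *)
Lemma weighted_iint_gt0 (h : 'rV[R]_n -> \bar R) : borel_fun h -> (forall x, 0 < h x)%E ->
  (0 < iint (fun x => (f x)%:E * h x))%E.
Proof.
move=> mh h0.
have [d [T [mu [rv [mrv [rvE _]]]]]] := iint_rep R n.
have mfh : borel_fun (fun x => (f x)%:E * h x)%E.
  by move=> d' T' c mc; apply: emeasurable_funM; [exact: (mf mc)|exact: mh].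
have fh0 x : (0 <= (f x)%:E * h x)%E by rewrite mule_ge0// ?lee_fin// ltW.
rewrite lt_neqAle iint_ge0// andbT eq_sym; apply/eqP.
rewrite rvE// => H.
have mfh' : measurable_fun setT (fun w => (f (rv w))%:E * h (rv w))%E by exact: mfh mrv.
have : ae_eq mu setT (fun w => (f (rv w))%:E * h (rv w))%E (cst 0%E).
  apply/(ae_eq_integral_abs mu measurableT mfh').
  by rewrite -[RHS]H; apply: eq_integral => w _; rewrite gee0_abs.
move=> [N [mN N0 NP]].
have : (iint (fun x => (f x)%:E) = 0)%E.
  rewrite rvE//.
  rewrite (integralE_off (g := fun=> 0%E) mN N0) ?integral0//.
  move=> w Nw; apply: contrapT => fw; apply: Nw; apply: NP => /= /(_ I) /eqP.
  by rewrite mule_eq0 => /orP[/eqP//|]; rewrite gt_eqF.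
by rewrite f1 => /eqP; rewrite onee_eq0.
Qed.

Lemma smooth_gt0 k z : (0 < smooth k z)%E.
Proof.
elim: k z => [|k IH] z /=; first by rewrite lte_fin expR_gt0.
apply: (@weighted_iint_gt0 (fun x => smooth k (z - x)%R)) => // d T c mc.
by apply: borel_smooth; apply: measurable_rowB => //; exact: measurable_row_cst.
Qed.

Lemma rsmooth_gt0 k z : 0 < rsmooth k z.
Proof. by rewrite -lte_fin -smoothE smooth_gt0. Qed.

(** Conditioning on the last summand: Tonelli, then a translation of the inner variable. *)
Lemma iint_smoothS (h : 'rV[R]_n -> R) k : (forall x, 0 <= h x) ->
  borel_fun (fun x => (h x)%:E) ->
  (iint (fun z => (h z)%:E * smooth k.+1 z) =
   iint (fun x => (f x)%:E * iint (fun z => (h (z + x)%R)%:E * smooth k z)))%E.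
Proof.
move=> h0 mh /=.
have G2 := borel_smooth_shift (borel_smooth k).
transitivity (iint (fun z => iint (fun x =>
    (h z)%:E * ((f x)%:E * smooth k (z - x)%R))))%E.
  apply: eq_iint => z; rewrite iintZ//.
    exact: (borel_fun2_section (G := fun z x => (f x)%:E * smooth k (z - x)%R)%E) G2.
  by move=> x; rewrite mule_ge0 ?lee_fin// smooth_ge0.
rewrite (iint_swap (G := fun z x => (h z)%:E * ((f x)%:E * smooth k (z - x)%R))%E); first last.
- by move=> z x; rewrite !mule_ge0 ?lee_fin// smooth_ge0.
- move=> d T u c mu mc; apply: emeasurable_funM; first exact: (mh _ _ _ mu).
  exact: G2.
apply: eq_iint => x.
transitivity (iint (fun z => (f x)%:E * ((h z)%:E * smooth k (z - x)%R)))%E.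
  by apply: eq_iint => z; rewrite muleCA.
have mhx : borel_fun (fun z => (h z)%:E * smooth k (z - x)%R)%E.
  move=> d T c mc; apply: emeasurable_funM; first exact: mh.
  by apply: borel_smooth; apply: measurable_rowB => //; exact: measurable_row_cst.
have hx0 z : (0 <= (h z)%:E * smooth k (z - x)%R)%E.
  by rewrite mule_ge0 ?lee_fin// smooth_ge0.
rewrite iintZ//; congr (_ * _)%E.
rewrite (iint_affine x mhx hx0 ltr01) expr1n mul1e; apply: eq_iint => z.
by rewrite scale1r addrK.
Qed.

Lemma iint_smooth k : iint (smooth k) = iint (smooth 0).
Proof.
elim: k => // k IH.
have -> : iint (smooth k.+1) = iint (fun z => 1%:E * smooth k.+1 z)%E.
  by apply: eq_iint => z; rewrite mul1e.
rewrite (@iint_smoothS (fun=> 1))//; last by move=> d T c mc; exact: measurable_cst.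
transitivity (iint (fun x => (f x)%:E * iint (smooth 0)))%E.
  by apply: eq_iint => x; rewrite -IH; congr (_ * _)%E; apply: eq_iint => z; rewrite mul1e.
have [detA IA] := gaussian_integral pA.
have -> : iint (smooth 0) = (Num.sqrt (2 * pi) ^+ n / Num.sqrt (\det A))%:E by exact: IA.
transitivity (iint (fun x => (Num.sqrt (2 * pi) ^+ n / Num.sqrt (\det A))%:E * (f x)%:E))%E.
  by apply: eq_iint => x; rewrite muleC.
rewrite iintZ ?f1 ?mule1// divr_ge0 ?exprn_ge0//.
Qed.

Definition half_space th (c : R) : set 'rV[R]_n := [set y | c <= dotv th y].

Lemma borel_half_space th (c : R) : borel_fun (fun x => (\1_(half_space th c) x : R)%:E).
Proof.
move=> d T v mv; apply/measurable_EFinP.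
have -> : (fun t => \1_(half_space th c) (v t)) = \1_[set t | c <= dotv th (v t)] :> (T -> R).
  by apply/funext => t; rewrite !indicE; congr (_ %:R); apply/idP/idP; rewrite !inE.
apply: measurable_indic; rewrite -[X in measurable X]setTI.
have mdot : measurable_fun setT (fun t => dotv th (v t)).
  by apply: measurable_sum => i; apply: measurable_funM => //; exact: mv.
by apply: (measurable_fun_ler (f := fun=> c) (g := fun t => dotv th (v t)) _ _ measurableT (Y := [set true])).
Qed.

(** If each of [k] summands satisfies [dotv th x >= s] and the Gaussian part satisfies
    [dotv th z >= 0], the sum is at level at least [k s]; independence multiplies the bounds. *)
Lemma smooth_halfspace th (s h J : R) k : 0 <= h -> 0 <= J ->
  (h%:E <= dmeasure f (half_space th s))%E ->
  (J%:E <= iint (fun z => (\1_(half_space th 0%R) z)%:E * smooth 0 z))%E ->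
  ((h ^+ k * J)%:E <=
   iint (fun z => (\1_(half_space th (k%:R * s)%R) z)%:E * smooth k z))%E.
Proof.
move=> h0 J0 hh hJ; elim: k => [|k IH].
  rewrite expr0 mul1r; apply: le_trans hJ _; apply: le_iint => z.
    by rewrite mule_ge0 ?lee_fin// smooth_ge0.
  by rewrite mul0r.
rewrite iint_smoothS//; last exact: borel_half_space.
set Ik := iint _ in IH.
apply: (@le_trans _ _ (iint (fun x => (h ^+ k * J)%:E * (\1_(half_space th s) x * f x)%:E))%E).
  rewrite iintZ ?mulr_ge0 ?exprn_ge0//; last 2 first.
  - move=> d T c mc; under eq_fun do rewrite EFinM.
    by apply: emeasurable_funM; [exact: borel_half_space|exact: (mf mc)].
  - by move=> x; rewrite lee_fin mulr_ge0.
  rewrite exprSr mulrAC EFinM; apply: lee_wpmul2l => //.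
  by rewrite lee_fin mulr_ge0// exprn_ge0.
apply: le_iint => x; first by rewrite mule_ge0// lee_fin ?mulr_ge0// exprn_ge0.
have [xs|xs] := boolP (x \in (half_space th s)); last first.
  rewrite indicE (negbTE xs) mul0r mule0; rewrite mule_ge0 ?lee_fin//.
  by apply: iint_ge0 => z; rewrite mule_ge0 ?lee_fin// smooth_ge0.
rewrite indicE xs mul1r muleC; apply: lee_wpmul2l; first by rewrite lee_fin.
apply: le_trans IH _; apply: le_iint => z; first by rewrite mule_ge0 ?lee_fin// smooth_ge0.
apply: lee_wpmul2r; first exact: smooth_ge0.
rewrite lee_fin !indicE ler_nat.
case: (boolP (z \in _)) => //; rewrite inE /half_space /= => hz.
rewrite mem_set// /half_space /= dotvDr -natr1 mulrDl mul1r lerD//.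
by move: xs; rewrite inE.
Qed.

(** The Gaussian is even, and one of [z], [- z] always lies in the half-space. *)
Lemma gaussian_halfspace th :
  (iint (smooth 0) <= 2%:E *
   iint (fun z => (\1_(half_space th 0%R) z)%:E * smooth 0 z))%E.
Proof.
pose P z : \bar R := ((\1_(half_space th 0%R) z)%:E * smooth 0 z)%E.
have P0 z : (0 <= P z)%E by rewrite /P mule_ge0 ?lee_fin// smooth_ge0.
have mP : borel_fun P.
  move=> d T c mc; apply: emeasurable_funM; first exact: borel_half_space.
  exact: borel_smooth.
have mPN : borel_fun (fun z => P (- z)).
  move=> d T c mc; apply: mP; under eq_fun do rewrite -scaleN1r.
  exact: measurable_rowZ.
have -> : (2%:E * iint P = iint P + iint (fun z => P (- z)%R))%E.
  by rewrite -(iint_opp mP P0) mule_natl mule2n.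
rewrite -iintD//; apply: le_iint => z; first exact: smooth_ge0.
have qN : smooth 0 (- z) = smooth 0 z.
  by rewrite /= !qfE; congr (expR (- _ / _))%:E; apply: eq_bigr => i _;
    apply: eq_bigr => j _; rewrite !mxE mulrNN.
rewrite /P qN; have [h|h] := leP 0 (dotv th z).
  have -> : \1_(half_space th 0) z = 1 :> R by rewrite indicE mem_set.
  by rewrite mul1e leeDl// mule_ge0 ?lee_fin// smooth_ge0.
rewrite [X in (_ + X)%E](_ : _ = smooth 0 z).
  by rewrite leeDr// mule_ge0 ?lee_fin// smooth_ge0.
have -> : \1_(half_space th 0) (- z) = 1 :> R.
  by rewrite indicE mem_set// /half_space /= -scaleN1r dotvZr mulN1r oppr_ge0 ltW.
by rewrite mul1e.
Qed.

(* From [e^-u >= e^-a (1 + a - u)]; the quadratic term is kept on the right so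
   that only nonnegative functions are integrated. *)
Lemma smooth_lower (tau a : R) k : 0 <= tau ->
  (forall z, iint (fun x => (f x * quad_form A (z - x))%:E) = (quad_form A z + tau)%:E) ->
  0 <= 1 + a - k%:R * tau / 2 -> forall z,
  ((expR (- a) * (1 + a - k%:R * tau / 2))%:E <=
   smooth k z + (expR (- a) / 2 * quad_form A z)%:E)%E.
Proof.
move=> tau0 hq; elim: k => [_ z|k IH hk z].
  rewrite /= -EFinD lee_fin !mul0r subr0.
  have := expR_ge1Dx (a - quad_form A z / 2); rewrite expRD => h.
  have e0 := expR_gt0 (- a).
  have := ler_wpM2l (ltW e0) h; rewrite mulrA -expRD addNr expR0 mul1r mulNr; lra.
have hk' : 0 <= 1 + a - k%:R * tau / 2.
  apply: le_trans hk _; rewrite lerD2l lerN2 ler_pM2r// ler_wpM2r//.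
  by rewrite ler_nat.
set b := expR (- a) / 2.
have b0 : 0 <= b by rewrite divr_ge0// expR_ge0.
set C := expR (- a) * (1 + a - k%:R * tau / 2).
have C0 : 0 <= C by rewrite mulr_ge0// expR_ge0.
have mfs : borel_fun (fun x => (f x)%:E * smooth k (z - x)%R)%E.
  apply: (borel_fun2_section (G := fun z x => (f x)%:E * smooth k (z - x)%R)%E).
  exact: borel_smooth_shift (borel_smooth k).
have mfq : borel_fun (fun x => (f x * quad_form A (z - x))%:E).
  move=> d T c mc; apply/measurable_EFinP; apply: measurable_funM.
    by apply/measurable_EFinP; exact: (mf mc).
  by apply: measurable_qf; apply: measurable_rowB => //; exact: measurable_row_cst.
have : (iint (fun x => C%:E * (f x)%:E) <=
   iint (fun x => (f x)%:E * smooth k (z - x)%R + b%:E * (f x * quad_form A (z - x))%:E))%E.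
  apply: le_iint => x; first by rewrite mule_ge0 ?lee_fin.
  have := IH hk' (z - x); rewrite smoothE -/b -/C -!EFinM -!EFinD !lee_fin => h.
  have := ler_wpM2l (f0 x) h; lra.
rewrite iintZ// f1 mule1 iintD//; first last.
- by move=> x; rewrite mule_ge0 ?lee_fin// mulr_ge0// posdef_ge0.
- by move=> x; rewrite mule_ge0 ?lee_fin// smooth_ge0.
- exact: borel_funZ.
rewrite iintZ//; last by move=> x; rewrite lee_fin mulr_ge0// posdef_ge0.
rewrite hq -/(smooth k.+1 z) smoothE -!EFinM -!EFinD !lee_fin => h.
rewrite -natr1 /C /b in h *; lra.
Qed.

Lemma rsmooth_log_concave k x y l : 0 < l < 1 ->
  rsmooth k x `^ l * rsmooth k y `^ (1 - l) <= rsmooth k (l *: x + (1 - l) *: y).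
Proof.
move=> l01; have := @log_concave_smooth k x y l _ _ l01 (rsmooth_gt0 k x) (rsmooth_gt0 k y).
by rewrite !smoothE !lee_fin; exact.
Qed.

Lemma smooth_superlevel_convexS k z :
  convex_subset [set v | rsmooth k z < rsmooth k (z + v)].
Proof.
move=> x y l l01 /= zx zy.
set c := Num.min (rsmooth k (z + x)) (rsmooth k (z + y)).
have zc : rsmooth k z < c by rewrite lt_min zx.
apply: (lt_le_trans zc).
have := @log_concave_ext_superlevel R _ (smooth k) c (smooth_ge0 k) (@log_concave_smooth k) (z + x) (z + y) l l01.
rewrite /= !smoothE !lee_fin !ge_min !lexx orbT => /(_ isT isT).
rewrite !scalerDr addrACA -scalerDl [l + _]addrC subrK scale1r.
by [].
Qed.

(** On the way from [z + y] to [z + (y + v)] the density is at least [c^e b^(1-e)], which tends to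
    [b > s] as [e] tends to 0. *)
Lemma smooth_superlevel_aopen k z :
  algebraic_open [set v | rsmooth k z < rsmooth k (z + v)].
Proof.
move=> y v /=; set s := rsmooth k z; set b := rsmooth k (z + y) => sb.
set c := rsmooth k (z + (y + v)).
have s0 : 0 < s by exact: rsmooth_gt0.
have b0 : 0 < b by exact: rsmooth_gt0.
have c0 : 0 < c by exact: rsmooth_gt0.
suff [e e01 h] : exists2 e, 0 < e < 1 & s < c `^ e * b `^ (1 - e).
  have /andP[e0 e1] := e01; exists e => //; apply: (lt_le_trans h).
  apply: le_trans (rsmooth_log_concave k (z + (y + v)) (z + y) e01) _.
  rewrite le_eqVlt; apply/orP; left; apply/eqP; congr rsmooth.
  by rewrite !scalerDr !scalerBl !scale1r; apply/rowP => i; rewrite !mxE; ring.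
have lsb : ln s < ln b by rewrite ltr_ln.
have E e : c `^ e * b `^ (1 - e) = expR (e * ln c + (1 - e) * ln b).
  by rewrite /powR !gt_eqF// -expRD.
have [bc|cb] := leP b c.
  exists (1 / 2); first lra.
  rewrite E -[s]lnK// ltr_expR.
  have : ln b <= ln c by rewrite ler_ln.
  lra.
have lcb : ln c < ln b by rewrite ltr_ln.
set L1 := ln b - ln c; set L2 := ln b - ln s.
have L10 : 0 < L1 by rewrite subr_gt0.
have L20 : 0 < L2 by rewrite subr_gt0.
have L120 : 0 < L1 + L2 by rewrite addr_gt0.
(* The logarithm drops by at most [e * L1], and this [e] keeps the drop below [L2 = ln b - ln s]. *)
exists (L2 / (L1 + L2)).
  by rewrite divr_gt0//= ltr_pdivrMr// mul1r ltrDr.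
rewrite E -[s]lnK// ltr_expR.
have -> : L2 / (L1 + L2) * ln c + (1 - L2 / (L1 + L2)) * ln b =
    ln b - L2 * (L1 / (L1 + L2)) by rewrite /L1; ring.
rewrite ltrBrDr -ltrBrDl -/L2 gtr_pMr//.
by rewrite ltr_pdivrMr// mul1r ltrDl.
Qed.

Lemma smooth_supporting_halfspace k z : (0 < n)%N ->
  exists2 th, th != 0 & forall y, dotv th z <= dotv th y -> rsmooth k y <= rsmooth k z.
Proof.
move=> n0.
have [|th thP] := separation_origin (@smooth_superlevel_convexS k z)
  (@smooth_superlevel_aopen k z).
  by rewrite /= addr0 ltxx.
have key y : rsmooth k z < rsmooth k y -> 0 < dotv th (y - z).
  by move=> h; apply: thP; rewrite /= addrC subrK.
(* A zero functional means that no point has larger density, so any nonzero direction serves. *)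
have [th0|thn0] := eqVneq th 0.
  exists (const_mx 1).
    apply/eqP => /rowP/(_ (Ordinal n0)); rewrite !mxE => /eqP.
    by rewrite oner_eq0.
  move=> y _; rewrite leNgt; apply/negP => /key.
  by rewrite th0 /dotv big1 ?ltxx// => i _; rewrite mxE mul0r.
exists (- th); first by rewrite oppr_eq0.
have dN u : dotv (- th) u = - dotv th u.
  by rewrite /dotv -sumrN; apply: eq_bigr => i _; rewrite mxE mulNr.
move=> y; rewrite !dN lerN2 => h; rewrite leNgt; apply/negP => /key.
rewrite dotvDr -scaleN1r dotvZr mulN1r subr_gt0 ltNge h//.
Qed.

Lemma rsmooth_half k y : rsmooth k y * rsmooth k 0 <= rsmooth k (2^-1 *: y) ^+ 2.
Proof.
have h2 : 0 < (2^-1 : R) < 1 by lra.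
have := rsmooth_log_concave k y 0 h2.
have -> : 1 - 2^-1 = 2^-1 :> R by lra.
rewrite scaler0 addr0 !powR12_sqrt ?(ltW (rsmooth_gt0 _ _))// => h.
rewrite -(sqr_sqrtr (ltW (rsmooth_gt0 k y))) -{1}(sqr_sqrtr (ltW (rsmooth_gt0 k 0))).
rewrite -exprMn ler_sqr ?nnegrE ?mulr_ge0//.
exact/ltW/rsmooth_gt0.
Qed.

(* With [p] the smoothed density, [H] a half-space with boundary through [2 z]
   and [p <= p z] on the parallel half-space through [z], log-concavity gives
   [p y <= p (y / 2) ^ 2 / p 0 <= p (y / 2) * p z / p 0] on [H]; integrate, and
   use that all summands lie in the half-space through [w = 2 z / m] with
   probability at least [h ^ m]. *)
Lemma tukey_depth_smooth m (w : 'rV[R]_n) (h : R) : (0 < n)%N -> 0 <= h ->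
  (h%:E <= tukey_depth f w)%E ->
  h ^+ m * rsmooth m 0 <= 2 ^+ n.+1 * rsmooth m ((m%:R / 2) *: w).
Proof.
move=> n0 h0 hw; set z := _ *: w.
have [th th0 thP] := smooth_supporting_halfspace m z n0.
set s := dotv th w.
have msE : m%:R * s = 2 * dotv th z by rewrite /z dotvZr -/s; field.
have half_space' : (h%:E <= dmeasure f (half_space th s))%E.
  apply: le_trans hw _; apply: ereal_inf_lbound; exists (half_space th s) => //.
  by split; [exists th, s|rewrite /half_space /=].
have [detA IA] := gaussian_integral pA.
set G := _ / _ in IA.
have G0 : 0 < G by rewrite /G divr_gt0 ?exprn_gt0 ?sqrtr_gt0// mulr_gt0// pi_gt0.
have hJ : ((G / 2)%:E <= iint (fun z => (\1_(half_space th 0%R) z)%:E * smooth 0 z))%E.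
  rewrite -(@lee_pmul2l _ 2%:E)// -EFinM mulrC mulfVK// -IA.
  exact: gaussian_halfspace.
have J0 : 0 <= G / 2 by rewrite divr_ge0// ltW.
have H1 := smooth_halfspace m h0 J0 half_space' hJ.
set r0 := rsmooth m 0; set rz := rsmooth m z.
have r00 : 0 < r0 by exact: rsmooth_gt0.
have rz0 : 0 < rz by exact: rsmooth_gt0.
have mh : borel_fun (fun y => smooth m (2^-1 *: y)).
  by move=> d T c mc; apply: borel_smooth; exact: measurable_rowZ.
have H2 : (iint (fun y => (\1_(half_space th (m%:R * s)%R) y)%:E * smooth m y) <=
    iint (fun y => (rz / r0)%:E * smooth m (2^-1 *: y)%R))%E.
  apply: le_iint => y; first by rewrite mule_ge0 ?lee_fin// smooth_ge0.
  rewrite indicE; case: (boolP (y \in _)) => [|_]; last first.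
    by rewrite mul0e mule_ge0 ?smooth_ge0// lee_fin divr_ge0// ltW.
  rewrite inE /half_space /= msE mulr1n mul1e !smoothE -EFinM lee_fin => hy.
  rewrite mulrAC ler_pdivlMr//.
  apply: le_trans (rsmooth_half m y) _; rewrite expr2 ler_pM2r ?rsmooth_gt0//.
  by apply: thP; rewrite (dotvZr 2^-1) ler_pdivlMl.
rewrite iintZ// in H2; last 2 first.
- by rewrite divr_ge0// ltW.
- by move=> y; exact: smooth_ge0.
(* The dilation by 2 costs [2^n]; with the 1/2 in [hJ] this makes [2^(n+1)]. The mass [G] cancels
   because convolution with [f] preserves it. *)
rewrite (@iint_affine _ _ _ 2 0 mh) in H2 => //; last by move=> y; exact: smooth_ge0.
have E2 : iint (fun x => smooth m (2^-1 *: (2 *: x + 0))) = G%:E.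
  rewrite -IA -[RHS]/(iint (smooth 0)) -(iint_smooth m); apply: eq_iint => x.
  by rewrite addr0 scalerA mulVf// scale1r.
rewrite E2 -!EFinM in H2.
have := le_trans H1 H2; rewrite lee_fin => H3.
rewrite -(@ler_pM2r _ (G / 2 / r0)); last by apply: divr_gt0 r00; apply: divr_gt0.
have -> : h ^+ m * r0 * (G / 2 / r0) = h ^+ m * (G / 2) by field; rewrite gt_eqF.
apply: le_trans H3 _; rewrite le_eqVlt; apply/orP; left; apply/eqP.
by rewrite exprS; field; rewrite gt_eqF.
Qed.

End smoothed_sum.

(** * Covariance *)

Section expectation.
Variable R : realType.

Definition hasint d (T : measurableType d) (mu : {measure set T -> \bar R})
    (u : T -> R) (r : R) :=
  mu.-integrable setT (EFin \o u) /\ (\int[mu]_w (u w)%:E = r%:E)%E.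

Lemma hasintD d (T : measurableType d) (mu : {measure set T -> \bar R}) u v r s :
  hasint mu u r -> hasint mu v s -> hasint mu (fun w => u w + v w) (r + s).
Proof.
move=> [iu Eu] [iv Ev]; split.
  by have := integrableD measurableT iu iv.
by have := integralD_EFin measurableT iu iv; rewrite /= Eu Ev.
Qed.

Lemma hasintZ d (T : measurableType d) (mu : {measure set T -> \bar R}) k u r :
  hasint mu u r -> hasint mu (fun w => k * u w) (k * r).
Proof.
move=> [iu Eu]; split.
  by have := integrableZl measurableT k iu.
by have := integralZl measurableT iu k; rewrite /= Eu.
Qed.

Lemma hasint_sum d (T : measurableType d) (mu : {measure set T -> \bar R})
    (I : finType) (u : I -> T -> R) (r : I -> R) :
  (forall i, hasint mu (u i) (r i)) ->
  hasint mu (fun w => \sum_i u i w) (\sum_i r i).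
Proof.
move=> h; elim: (index_enum I) => [|i s IH].
  under eq_fun do rewrite big_nil; rewrite big_nil; split; last exact: integral0.
  exact: integrable0.
under eq_fun do rewrite big_cons; rewrite big_cons.
exact: hasintD.
Qed.

Variables (n : nat) (f : 'rV[R]_n -> R).
Hypothesis f0 : forall x, 0 <= f x.
Hypothesis cf : log_concave_ext (fun x => (f x)%:E).
Hypothesis mf : borel_fun (fun x => (f x)%:E).
Hypothesis f1 : iint (fun x => (f x)%:E) = 1%E.
Hypothesis bf : centered f.

(** Expand the form; the linear terms vanish because [f] is centered. Second moments dominate the
    first and mixed ones, so each [fine] in the definitions returns a true integral. *)
Lemma expect_qf (B : 'M[R]_n) z :
  iint (fun x => (f x * quad_form B (z - x))%:E) =
  (quad_form B z + \sum_i \sum_j B i j * Defs.covariance f i j)%:E.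
Proof.
have [d [T [mu [rv [mrv [rvE rvI]]]]]] := iint_rep R n.
have mfr : measurable_fun setT (fun w => f (rv w)).
  by apply/measurable_EFinP; exact: mf mrv.
have hf : hasint mu (fun w => f (rv w)) 1.
  have E : (\int[mu]_w (f (rv w))%:E = 1%:E)%E by rewrite -(rvE (fun x => (f x)%:E)).
  split=> //; apply/integrableP; split; first exact/measurable_EFinP.
  rewrite (eq_integral (fun w => (f (rv w))%:E)) ?E ?ltry// => w _.
  by rewrite /= ger0_norm.
have int2 i : mu.-integrable setT (EFin \o (fun w => rv w 0 i ^+ 2 * f (rv w))).
  apply/integrableP; split.
    by apply/measurable_EFinP; apply: measurable_funM => //; apply: measurable_funX; exact: mrv.
  have := log_concave_second_moment i cf mf f0 _; rewrite f1 ltry => /(_ isT).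
  rewrite rvE; last by move=> x; rewrite mule_ge0 ?lee_fin// sqr_ge0.
    congr (_ < _)%E; apply: eq_integral => w _ /=.
    by rewrite ger0_norm// mulr_ge0// sqr_ge0.
  move=> d' T' c mc; apply: emeasurable_funM; last exact: (mf mc).
  by apply/measurable_EFinP; apply: measurable_funX; exact: mc.
have toint (u : 'rV[R]_n -> R) : borel_fun (fun x => (u x)%:E) ->
    mu.-integrable setT (EFin \o (u \o rv)) ->
    hasint mu (u \o rv) (fine (iint (fun x => (u x)%:E))).
  move=> mu' iu; split => //.
  rewrite (rvI _ mu' iu) fineK//.
  exact: integrable_fin_num.
have hi i : hasint mu (fun w => rv w 0 i * f (rv w)) 0.
  rewrite -(bf i); apply: (toint (fun x => x 0 i * f x)).
    move=> d' T' c mc; apply/measurable_EFinP; apply: measurable_funM; first exact: mc.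
    by apply/measurable_EFinP; exact: mf mc.
  apply: (@le_integrable _ _ _ mu setT measurableT _ (EFin \o (fun w => rv w 0 i ^+ 2 * f (rv w) + f (rv w)))).
  - apply/measurable_EFinP; apply: measurable_funM => //; exact: mrv.
  - move=> w _ /=; rewrite lee_fin [leRHS]ger0_norm; last first.
      by rewrite addr_ge0// mulr_ge0// sqr_ge0.
    rewrite normrM (ger0_norm (f0 _)) -{3}[f _]mul1r -mulrDl ler_wpM2r//.
    rewrite -[X in _ <= X + _](@real_normK _ (rv w 0 i)) ?num_real//.
    by have := sqr_ge0 (`|rv w 0 i| - 1); nra.
  - by have := integrableD measurableT (int2 i) hf.1.
have hij i j : hasint mu (fun w => rv w 0 i * rv w 0 j * f (rv w)) (Defs.covariance f i j).
  rewrite mxE !bf mulr0 subr0; apply: (toint (fun x => x 0 i * x 0 j * f x)).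
    move=> d' T' c mc; apply/measurable_EFinP; apply: measurable_funM.
      by apply: measurable_funM; exact: mc.
    by apply/measurable_EFinP; exact: mf mc.
  apply: (@le_integrable _ _ _ mu setT measurableT _
    (EFin \o (fun w => rv w 0 i ^+ 2 * f (rv w) + rv w 0 j ^+ 2 * f (rv w)))).
  - by apply/measurable_EFinP; apply: measurable_funM => //; apply: measurable_funM; exact: mrv.
  - move=> w _ /=; rewrite lee_fin [leRHS]ger0_norm; last first.
      by rewrite addr_ge0// mulr_ge0// sqr_ge0.
    rewrite normrM (ger0_norm (f0 _)) -mulrDl ler_wpM2r// normrM.
    rewrite -[X in _ <= X + _](@real_normK _ (rv w 0 i)) ?num_real//.
    rewrite -[X in _ <= _ + X](@real_normK _ (rv w 0 j)) ?num_real//.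
    have := sqr_ge0 (`|rv w 0 i| - `|rv w 0 j|).
    have := normr_ge0 (rv w 0 i); have := normr_ge0 (rv w 0 j); nra.
  - by have := integrableD measurableT (int2 i) (int2 j).
have hT : hasint mu (fun w => f (rv w) * quad_form B (z - rv w))
   (quad_form B z + \sum_i \sum_j B i j * Defs.covariance f i j).
  have -> : (fun w => f (rv w) * quad_form B (z - rv w)) =
      (fun w => \sum_i \sum_j B i j * (z 0 i * z 0 j * f (rv w) +
         (- z 0 i * (rv w 0 j * f (rv w)) + (- z 0 j * (rv w 0 i * f (rv w)) +
         rv w 0 i * rv w 0 j * f (rv w))))).
    apply/funext => w; rewrite qfE mulr_sumr; apply: eq_bigr => i _.
    by rewrite mulr_sumr; apply: eq_bigr => j _; rewrite !mxE; ring.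
  have -> : quad_form B z + \sum_i \sum_j B i j * Defs.covariance f i j =
      \sum_i \sum_j B i j * (z 0 i * z 0 j * 1 + (- z 0 i * 0 + (- z 0 j * 0 + Defs.covariance f i j))).
    rewrite qfE -big_split; apply: eq_bigr => i _ /=.
    by rewrite -big_split; apply: eq_bigr => j _ /=; ring.
  apply: hasint_sum => i; apply: hasint_sum => j; apply: hasintZ.
  apply: hasintD; first exact: hasintZ.
  apply: hasintD; first exact: hasintZ.
  apply: hasintD; first exact: hasintZ.
  exact: hij.
rewrite -hT.2; apply: (rvI (fun x => (f x * quad_form B (z - x))%:E)); last exact: hT.1.
move=> d' T' c mc; apply/measurable_EFinP; apply: measurable_funM.
  by apply/measurable_EFinP; exact: mf mc.
by apply: measurable_qf; apply: measurable_rowB => //; exact: measurable_row_cst.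
Qed.

Lemma covariance_sym : (Defs.covariance f)^T = Defs.covariance f.
Proof.
apply/matrixP => i j; rewrite !mxE !bf !mulr0; congr (fine _ - _).
by apply: eq_iint => x; rewrite [x 0 j * _]mulrC.
Qed.

(** For the rank-one form [B = v^T v], [expect_qf] at 0 exhibits the value as the integral of a
    square against [f]. *)
Lemma covariance_ge0 v : 0 <= quad_form (Defs.covariance f) v.
Proof.
have := expect_qf (v^T *m v) 0; rewrite qf0 add0r => E.
have qE x : quad_form (v^T *m v) x = ((x *m v^T) 0 0) ^+ 2.
  rewrite /quad_form !mulmxA -mulmxA mxE big_ord1 expr2; congr (_ * _).
  by rewrite !mxE; apply: eq_bigr => i _; rewrite !mxE mulrC.
have -> : quad_form (Defs.covariance f) v = \sum_i \sum_j (v^T *m v) i j * Defs.covariance f i j.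
  rewrite qfE; apply: eq_bigr => i _; apply: eq_bigr => j _.
  by rewrite mulrC; congr (_ * _); rewrite mxE big_ord1 mxE.
rewrite -lee_fin -E; apply: iint_ge0 => x; rewrite lee_fin mulr_ge0// qE.
exact: sqr_ge0.
Qed.

(* A positive semidefinite invertible matrix is definite: test the form on
   [y + t x] with [x = y S]. *)
Lemma posdef_invmx_covariance : \det (Defs.covariance f) != 0 ->
  posdef (invmx (Defs.covariance f)).
Proof.
set S := Defs.covariance f => dS.
have uS : S \in unitmx by rewrite unitmxE unitfE.
split; first by rewrite trmx_inv covariance_sym.
move=> x x0; have [y yD] : exists y, y = x *m invmx S by exists (x *m invmx S).
have xE : x = y *m S by rewrite yD mulmxKV.
have yE : quad_form (invmx S) x = quad_form S y.
  by rewrite /quad_form -yD [in X in _ *m X]xE trmx_mul covariance_sym mulmxA.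
rewrite yE lt_neqAle covariance_ge0 andbT eq_sym; apply/eqP => q0.
pose b := dotv x x; pose c := quad_form S x.
have c0 : 0 <= c by exact: covariance_ge0.
have qt t : 0 <= 2 * t * b + t ^+ 2 * c.
  have := covariance_ge0 (y + t *: x).
  have -> : quad_form S (y + t *: x) = quad_form S y + 2 * t * b + t ^+ 2 * c.
    rewrite /c /quad_form !mulmxDl linearD /= linearZ /= !mulmxDr -!scalemxAl -!scalemxAr.
    have e1 : (y *m S *m x^T) 0 0 = b.
      rewrite -xE /b /dotv mxE; apply: eq_bigr => i _.
      by rewrite mxE.
    have e2 : (x *m S *m y^T) 0 0 = b.
      rewrite -e1 -[x *m S *m y^T]trmxK mxE !trmx_mul trmxK covariance_sym -/S.
      by rewrite mulmxA.
    by rewrite !mxE in e1 e2 *; rewrite e1 e2; ring.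
  by rewrite q0 add0r.
have b0 : 0 < b.
  rewrite lt_neqAle dotv_ge0 andbT eq_sym; apply/eqP => /dotv_eq0 xz.
  by rewrite xz eqxx in x0.
(* Near the minimizer [- b / c]; the [+ 1] covers [c = 0]. *)
have := qt (- b / (c + 1)).
have c1 : 0 < c + 1 by rewrite ltr_wpDl.
have -> : 2 * (- b / (c + 1)) * b + (- b / (c + 1)) ^+ 2 * c =
   - (b ^+ 2 * (c + 2)) / (c + 1) ^+ 2 by field; rewrite gt_eqF.
apply/negP; rewrite -ltNge mulNr oppr_lt0 divr_gt0 ?exprn_gt0// mulr_gt0 ?exprn_gt0//.
by rewrite ltr_wpDl.
Qed.

Lemma expect_qf_invmx (k : R) z : \det (Defs.covariance f) != 0 ->
  iint (fun x => (f x * quad_form (k *: invmx (Defs.covariance f)) (z - x))%:E) =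
  (quad_form (k *: invmx (Defs.covariance f)) z + k * n%:R)%:E.
Proof.
set S := Defs.covariance f => dS.
have uS : S \in unitmx by rewrite unitmxE unitfE.
rewrite expect_qf; congr (_ + _)%:E.
have -> : n%:R = \tr (invmx S *m S) by rewrite mulVmx// mxtrace1.
rewrite mulr_sumr; apply: eq_bigr => i _; rewrite [in RHS]mxE mulr_sumr.
apply: eq_bigr => j _; rewrite mxE mulrA; congr (_ * _).
by have /matrixP/(_ j i) := covariance_sym; rewrite [LHS]mxE.
Qed.

End expectation.

(** * Half-space depth *)

Section depth.
Variable R : realType.

Lemma tukey_depth_ge0 n (f : 'rV[R]_n -> R) w : (forall x, 0 <= f x) ->
  (0 <= tukey_depth f w)%E.
Proof.
move=> f0; apply: le_ereal_inf_tmp => _ [H _ <-].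
by apply: iint_ge0 => x; rewrite lee_fin mulr_ge0.
Qed.

Lemma tukey_depth_le1 n (f : 'rV[R]_n -> R) w : (0 < n)%N -> (forall x, 0 <= f x) ->
  iint (fun x => (f x)%:E) = 1%E -> (tukey_depth f w <= 1)%E.
Proof.
move=> n0 f0 f1; pose th : 'rV[R]_n := const_mx 1.
have thn0 : th != 0.
  apply/eqP => /rowP/(_ (Ordinal n0)); rewrite !mxE => /eqP.
  by rewrite oner_eq0.
apply: (@le_trans _ _ (dmeasure f (half_space th (dotv th w)))).
  apply: ereal_inf_lbound; exists (half_space th (dotv th w)) => //; split.
    by exists th, (dotv th w).
  by rewrite /half_space /=.
rewrite -f1; apply: le_iint => x; first by rewrite lee_fin mulr_ge0.
by rewrite lee_fin ler_piMl// indicE lern1 leq_b1.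
Qed.

Lemma sqrtr_exprn (x : R) k : 0 <= x -> Num.sqrt (x ^+ k) = Num.sqrt x ^+ k.
Proof.
move=> x0; elim: k => [|k IH]; first by rewrite !expr0 sqrtr1.
by rewrite !exprS sqrtrM// IH.
Qed.

Lemma bernoulli (u : R) m : 0 <= u -> 1 + m%:R * (u - 1) <= u ^+ m.
Proof.
move=> u0; elim: m => [|m IH]; first by rewrite mul0r addr0 expr0.
rewrite exprS -natr1; have := ler_wpM2l u0 IH.
have m0 : 0 <= m%:R :> R by [].
have := mulr_ge0 m0 (sqr_ge0 (u - 1)); nra.
Qed.

Lemma supnorm_ub n (f : 'rV[R]_n -> R) x : supnorm f \is a fin_num ->
  f x <= fine (supnorm f).
Proof.
move=> fin; rewrite -lee_fin fineK//; apply: ereal_sup_ubound.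
by exists x.
Qed.

Lemma isotropic_const_exprn n (f : 'rV[R]_n -> R) : (0 < n)%N ->
  0 <= fine (supnorm f) -> 0 <= \det (Defs.covariance f) ->
  isotropic_const f ^+ n = fine (supnorm f) * Num.sqrt (\det (Defs.covariance f)).
Proof.
move=> n0 M0 D0; rewrite /isotropic_const exprMn -!powR_mulrn ?powR_ge0//.
rewrite -!powRrM mulVf ?pnatr_eq0 -?lt0n// powRr1//; congr (_ * _).
rewrite -powR12_sqrt//; congr (_ `^ _).
by rewrite natrM; field; rewrite pnatr_eq0 -lt0n.
Qed.

(** The numerical hypothesis makes an upper bound for [e^n M] times the integral of [depth^m] at
    most 1. Its factors are the constant of [tukey_depth_smooth] over the lower bound for [p(0)],
    the Jacobian of [w -> (m / 2) w], and the mass of the Gaussian with covariance [m Cov]. *)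
Lemma integral_depth_le n (f g : 'rV[R]_n -> R) (M : R) (m : nat) :
  (0 < n)%N -> (0 < m)%N ->
  (forall x, 0 <= f x) -> log_concave_ext (fun x => (f x)%:E) -> borel_fun (fun x => (f x)%:E) ->
  iint (fun x => (f x)%:E) = 1%E -> centered f ->
  (forall x, 0 <= g x <= M) -> borel_fun (fun x => (g x)%:E) ->
  iint (fun x => (g x)%:E) = 1%E ->
  0 < \det (Defs.covariance f) ->
  expR n%:R * M * (2 ^+ n.+1 / expR (- (n%:R / 2)) *
    ((2 / m%:R) ^+ n * (Num.sqrt (2 * pi) ^+ n *
       (Num.sqrt m%:R ^+ n * Num.sqrt (\det (Defs.covariance f)))))) <= 1 ->
  (iint (fun x => tukey_depth f x * (g x)%:E) <=
   (expR (- (n%:R / m%:R)))%:E)%E.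
Proof.
move=> n0 m0 f0 cf mf f1 bf gM mg g1 D0 HQ.
set S := Defs.covariance f in D0 HQ *.
have M0 : 0 <= M by case/andP: (gM 0) => /le_trans; exact.
have nR0 : 0 < n%:R :> R by rewrite ltr0n.
have mR0 : 0 < m%:R :> R by rewrite ltr0n.
(* Each summand then adds [n / m] to the mean of the quadratic form, and [a = n / 2] in
   [smooth_lower] makes its bracket equal to 1. *)
pose A := (m%:R)^-1 *: invmx S.
have dS : \det S != 0 by rewrite gt_eqF.
have pS : posdef (invmx S) by exact: posdef_invmx_covariance.
have pA : posdef A.
  have [s1 s2] := pS; split; first by rewrite /A linearZ /= s1.
  by move=> x x0; rewrite qf_scale mulr_gt0 ?invr_gt0//; exact: s2.
have [_ IA] := gaussian_integral pA.
set G := _ / _ in IA.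
have GE : G = Num.sqrt (2 * pi) ^+ n * (Num.sqrt m%:R ^+ n * Num.sqrt (\det S)).
  rewrite /G /A detZ det_inv exprVn; congr (_ * _).
  have mS : 0 <= m%:R ^- n :> R by rewrite invr_ge0 exprn_ge0// ltW.
  rewrite (sqrtrM _ mS) !sqrtrV ?exprn_ge0 ?(ltW mR0) ?(ltW D0)//.
  rewrite invfM !invrK; congr (_ * _).
  by rewrite sqrtr_exprn// ltW.
set r := rsmooth f A m.
have rE z : smooth f A m z = (r z)%:E by exact: smoothE.
have r0 : expR (- (n%:R / 2)) <= r 0.
  have hq z : iint (fun x => (f x * quad_form A (z - x))%:E) = (quad_form A z + (m%:R)^-1 * n%:R)%:E.
    exact: expect_qf_invmx.
  have tau0 : 0 <= (m%:R)^-1 * n%:R :> R by rewrite mulr_ge0 ?invr_ge0 ?ltW.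
  have := @smooth_lower _ _ f A f0 mf f1 pA _ (n%:R / 2) m tau0 hq.
  have -> : 1 + n%:R / 2 - m%:R * ((m%:R)^-1 * n%:R) / 2 = 1 :> R.
    by field; rewrite gt_eqF.
  by rewrite ler01 => /(_ isT 0); rewrite qf0 mulr0 mulr1 adde0 rE lee_fin.
have r00 : 0 < r 0 by apply: lt_le_trans r0; exact: expR_gt0.
have r_ge0 z : 0 <= r z by rewrite -lee_fin -rE smooth_ge0.
pose k : R := expR (- (n%:R / m%:R)).
have k0 : 0 < k by exact: expR_gt0.
(* The pointwise bound of [depth * g]: the m-th power is traded for the smoothed density, with
   [g <= M], and the constant term keeps [g]. *)
pose c1 := k * (expR n%:R / m%:R * (2 ^+ n.+1 / expR (- (n%:R / 2)) * M)).
pose c2 := k * (1 - (m%:R)^-1).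
have c10 : 0 <= c1 by rewrite /c1 !mulr_ge0 ?invr_ge0 ?expR_ge0 ?exprn_ge0 ?(ltW k0) ?(ltW mR0).
have c20 : 0 <= c2.
  by rewrite mulr_ge0 ?(ltW k0)// subr_ge0 invf_le1// ler1n.
have mr : borel_fun (fun w => smooth f A m ((m%:R / 2) *: w)).
  by move=> d T c mc; apply: borel_smooth => //; exact: measurable_rowZ.
apply: (@le_trans _ _ (iint (fun w => c1%:E * smooth f A m ((m%:R / 2) *: w)%R
    + c2%:E * (g w)%:E))%E).
  apply: le_iint => w.
    by rewrite mule_ge0 ?tukey_depth_ge0// lee_fin; case/andP: (gM w).
  have t0 := tukey_depth_ge0 w f0; have t1 := tukey_depth_le1 w n0 f0 f1.
  have tfin : tukey_depth f w \is a fin_num.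
    by rewrite ge0_fin_numE//; apply: le_lt_trans t1 _; rewrite ltry.
  set h := fine (tukey_depth f w).
  have hE : tukey_depth f w = h%:E by rewrite fineK.
  have h0 : 0 <= h by rewrite -lee_fin -hE.
  have := tukey_depth_smooth f0 cf mf f1 pA m n0 h0.
  move=> /(_ w); rewrite hE => /(_ (lexx _)) H.
  rewrite rE -!EFinM -EFinD lee_fin.
  have /andP[gw0 gwM] := gM w.
  rewrite -/r in H; set rw := r (_ *: w) in H *.
  have rw0 : 0 <= rw by exact: r_ge0.
  have Hm : h ^+ m <= 2 ^+ n.+1 / expR (- (n%:R / 2)) * rw.
    rewrite mulrAC ler_pdivlMr ?expR_gt0//; apply: le_trans H.
    by rewrite ler_wpM2l// exprn_ge0.
  (* Bernoulli's inequality for [u = h e^(n/m)]. *)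
  have key : h <= k * (expR n%:R / m%:R * h ^+ m + (1 - (m%:R)^-1)).
    pose u := h / k.
    have u0 : 0 <= u by rewrite divr_ge0// ltW.
    have := bernoulli m u0.
    have -> : u ^+ m = expR n%:R * h ^+ m.
      rewrite /u expr_div_n mulrC; congr (_ * _).
      rewrite /k -expRM_natl -expRN; congr expR.
      by field; rewrite gt_eqF.
    move=> hb.
    have -> : k * (expR n%:R / m%:R * h ^+ m + (1 - (m%:R)^-1)) =
        k * (expR n%:R * h ^+ m + m%:R - 1) / m%:R by field; rewrite gt_eqF.
    have hk : h = k * u by rewrite /u mulrC mulfVK// gt_eqF.
    rewrite {1}hk -mulrA ler_pM2l// ler_pdivlMr//; lra.
  have k1 : k * (expR n%:R / m%:R) >= 0.
    by rewrite mulr_ge0 ?(ltW k0)// divr_ge0 ?expR_ge0// ltW.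
  apply: (@le_trans _ _ (k * (expR n%:R / m%:R * h ^+ m + (1 - (m%:R)^-1)) * g w)).
    by rewrite ler_wpM2r.
  rewrite mulrDr mulrDl; apply: lerD => //.
  rewrite mulrA -mulrA.
  apply: (@le_trans _ _ (k * (expR n%:R / m%:R) * (2 ^+ n.+1 / expR (- (n%:R / 2)) * rw * M))).
    rewrite ler_wpM2l//; apply: ler_pM => //; exact: exprn_ge0.
  by rewrite /c1 le_eqVlt; apply/orP; left; apply/eqP; ring.
rewrite iintD; first last.
- by move=> x; rewrite mule_ge0// lee_fin; case/andP: (gM x).
- by move=> x; rewrite mule_ge0// ?lee_fin// smooth_ge0.
- exact: borel_funZ.
- exact: borel_funZ.
rewrite !iintZ//; first last.
- by move=> x; exact: smooth_ge0.
- by move=> x; rewrite lee_fin; case/andP: (gM x).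
rewrite g1 mule1.
have two0 : 0 < 2 / m%:R :> R by rewrite divr_gt0.
rewrite (iint_affine 0 mr _ two0); last by move=> x; exact: smooth_ge0.
have -> : iint (fun x => smooth f A m ((m%:R / 2) *: ((2 / m%:R) *: x + 0))) = G%:E.
  rewrite -IA -[RHS]/(iint (smooth f A 0)) -(@iint_smooth _ _ f A f0 mf f1 pA m).
  apply: eq_iint => x; rewrite addr0 scalerA.
  have -> : m%:R / 2 * (2 / m%:R) = 1 :> R by field; rewrite gt_eqF.
  by rewrite scale1r.
rewrite -!EFinM -EFinD lee_fin -/k GE /c1 /c2.
set Q := (X in X <= 1) in HQ.
have -> : k * (expR n%:R / m%:R * (2 ^+ n.+1 / expR (- (n%:R / 2)) * M)) *
  ((2 / m%:R) ^+ n * (Num.sqrt (2 * pi) ^+ n * (Num.sqrt m%:R ^+ n * Num.sqrt (\det S)))) =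
  k * (Q / m%:R) by rewrite /Q; ring.
rewrite -mulrDr ler_piMr ?(ltW k0)//.
have : Q / m%:R <= (m%:R)^-1 by rewrite ler_piMl ?invr_ge0 ?(ltW mR0).
lra.
Qed.

(** A lower bound for the isotropic constant. The integral of [f] against a Gaussian weight with
    covariance [Cov] is at least [e^(-n/2)] by [smooth_lower] with one summand, and at most [M]
    times the Gaussian mass. *)
Lemma expR_le_bound_det_covariance n (f : 'rV[R]_n -> R) (M : R) :
  (0 < n)%N ->
  (forall x, 0 <= f x <= M) -> log_concave_ext (fun x => (f x)%:E) -> borel_fun (fun x => (f x)%:E) ->
  iint (fun x => (f x)%:E) = 1%E -> centered f ->
  0 < \det (Defs.covariance f) ->
  expR (- (n%:R / 2)) <= M * (Num.sqrt (2 * pi) ^+ n * Num.sqrt (\det (Defs.covariance f))).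
Proof.
move=> n0 fM cf mf f1 bf D0.
set S := Defs.covariance f in D0 *.
have f0 x : 0 <= f x by case/andP: (fM x).
have M0 : 0 <= M by case/andP: (fM 0) => /le_trans; exact.
pose A := 1 *: invmx S.
have dS : \det S != 0 by rewrite gt_eqF.
have pA : posdef A by rewrite /A scale1r; exact: posdef_invmx_covariance.
have [_ IA] := gaussian_integral pA.
have hq z : iint (fun x => (f x * quad_form A (z - x))%:E) = (quad_form A z + 1 * n%:R)%:E.
  exact: expect_qf_invmx.
have tau0 : 0 <= 1 * n%:R :> R by rewrite mul1r.
have := @smooth_lower _ _ f A f0 mf f1 pA _ (n%:R / 2) 1 tau0 hq.
have -> : 1 + n%:R / 2 - 1%:R * (1 * n%:R) / 2 = 1 :> R by ring.
rewrite ler01 => /(_ isT 0); rewrite qf0 mulr0 mulr1 adde0 => H.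
rewrite -lee_fin; apply: (le_trans H).
have m0 : borel_fun (smooth f A 0) by exact: borel_smooth.
have m0N : borel_fun (fun x => smooth f A 0 (0 - x)).
  by move=> d T c mc; apply: m0; apply: measurable_rowB => //; exact: measurable_row_cst.
apply: (@le_trans _ _ (iint (fun x => M%:E * smooth f A 0 (0 - x)%R))%E).
  apply: le_iint => x; first by rewrite mule_ge0 ?lee_fin// expR_ge0.
  apply: lee_wpmul2r; first by rewrite lee_fin expR_ge0.
  by rewrite lee_fin; case/andP: (fM x).
rewrite iintZ//; last by move=> x; rewrite lee_fin expR_ge0.
rewrite EFinM; apply: lee_wpmul2l; first by rewrite lee_fin.
have -> : iint (fun x => smooth f A 0 (0 - x)) = iint (smooth f A 0).
  rewrite [RHS]iint_opp//; last by move=> x; rewrite lee_fin expR_ge0.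
  by apply: eq_iint => x; rewrite sub0r.
rewrite -[iint _]/(iint (fun x => (expR (- quad_form A x / 2))%:E)) IA lee_fin.
rewrite /A scale1r det_inv sqrtrV ?(ltW D0)// invrK.
by [].
Qed.

End depth.

(** * Choice of the constants and conclusion *)

Theorem theorem3p2 (R : realType) :
  exists (c : R) (n0 : nat), 0 < c /\
    forall (n : nat) (fmu fnu : 'rV[R]_n -> R),
      (n0 <= n)%N ->
      log_concave_density fmu -> centered fmu ->
      log_concave_density fnu -> centered fnu ->
      supnorm fmu = supnorm fnu ->
      (iint (fun x => tukey_depth fmu x * (fnu x)%:E)
        <= (expR (- (c * n%:R) / (isotropic_const fmu) ^+ 2))%:E)%E.
Proof.
(* The n-th roots of [2^n], of the Jacobian [2^n], of [e^n], of [1 / p(0)] and of the Gaussian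
   mass. *)
pose B : R := 2 * 2 * expR 1 * expR (1 / 2) * Num.sqrt (2 * pi).
(* For [m >= K L^2] this gives [q = B L / sqrt m <= 1/2]. *)
pose K : R := 4 * B ^+ 2.
have s2pi : 0 < Num.sqrt (2 * pi) :> R by rewrite sqrtr_gt0 mulr_gt0// pi_gt0.
have B0 : 0 < B by rewrite /B !mulr_gt0// expR_gt0.
have K0 : 0 < K by rewrite /K mulr_gt0// exprn_gt0.
(* The second term pays for rounding up: [1 <= 2 pi e L^2], so [m <= K L^2 + 1 <= C L^2]. *)
pose C : R := K + 2 * pi * expR 1.
have pe0 : 0 < 2 * pi * expR 1 :> R by rewrite !mulr_gt0// ?pi_gt0// expR_gt0.
have C0 : 0 < C by rewrite addr_gt0.
exists C^-1, 1%N; split; first by rewrite invr_gt0.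
move=> n fmu fnu n0 [lmu imu] cmu [lnu inu] cnu MM.
have [f [ff cf mf fI]] := borel_version lmu.
have [g [gg cg mg gI]] := borel_version lnu.
have f0 x : 0 <= f x by case/andP: (ff x).
have g0 x : 0 <= g x by case/andP: (gg x).
have f1 : iint (fun x => (f x)%:E) = 1%E.
  by rewrite -imu (fI (fun _ r => r%:E)).
have g1 : iint (fun x => (g x)%:E) = 1%E.
  by rewrite -inu (gI (fun _ r => r%:E)).
have bE : barycenter fmu = barycenter f.
  by apply/funext => i; rewrite /barycenter (fI (fun x r => (x 0 i * r)%:E)).
have cmf : centered f by move=> i; rewrite -bE.
have covE : Defs.covariance fmu = Defs.covariance f.
  apply/matrixP => i j; rewrite !mxE bE.
  by rewrite (fI (fun x r => (x 0 i * x 0 j * r)%:E)).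
have tE : tukey_depth fmu = tukey_depth f.
  apply/funext => x; rewrite /tukey_depth; congr ereal_inf.
  have dE H : dmeasure fmu H = dmeasure f H.
    by rewrite /dmeasure (fI (fun y r => (\1_H y * r)%:E)).
  by apply/seteqP; split => _ [H hH <-]; exists H; rewrite ?dE.
rewrite (gI (fun x r => tukey_depth fmu x * r%:E)%E) tE.
set L := isotropic_const fmu.
(* An infinite supremum or a zero determinant reads as [L = 0]; division by zero then makes the
   right-hand side 1, and the depth is at most 1. *)
have [L0|L0] := eqVneq L 0.
  rewrite L0 expr0n /= invr0 mulr0 expR0 -g1; apply: le_iint => x.
    by rewrite mule_ge0 ?tukey_depth_ge0// lee_fin.
  rewrite -[leRHS]mul1e; apply: lee_wpmul2r; first by rewrite lee_fin.
  exact: tukey_depth_le1.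
have Lge0 : 0 <= L by rewrite /L /isotropic_const mulr_ge0// powR_ge0.
have Lgt0 : 0 < L by rewrite lt_neqAle eq_sym L0.
(* The supremum of the original density: the Borel versions lie below it. *)
set M := fine (supnorm fmu).
have nR : n%:R != 0 :> R by rewrite pnatr_eq0 -lt0n.
have Mn0 : M != 0.
  apply: contra_neq L0 => M0; rewrite /L /isotropic_const -/M M0.
  by rewrite powR0 ?mul0r// invr_eq0.
have Mfin : supnorm fmu \is a fin_num.
  by move: Mn0; rewrite /M; case: (supnorm fmu) => //; rewrite /= eqxx.
have fM x : 0 <= f x <= M.
  rewrite f0 /=; case/andP: (ff x) => _ /le_trans; apply.
  exact: supnorm_ub.
have gM x : 0 <= g x <= M.
  rewrite g0 /=; case/andP: (gg x) => _ /le_trans; apply.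
  by rewrite /M MM; apply: supnorm_ub; rewrite -MM.
have M0 : 0 <= M by case/andP: (fM 0) => /le_trans; exact.
have Dn0 : \det (Defs.covariance f) != 0.
  apply: contra_neq L0 => D0; rewrite /L /isotropic_const covE D0.
  by rewrite [X in _ * X]powR0 ?mulr0// invr_eq0 pnatr_eq0 muln_eq0 -lt0n n0.
have D0 : 0 < \det (Defs.covariance f).
  have [+ _] := gaussian_integral (posdef_invmx_covariance f0 cf mf f1 cmf Dn0).
  by rewrite det_inv invr_gt0.
have LE : L ^+ n = M * Num.sqrt (\det (Defs.covariance f)).
  rewrite /L isotropic_const_exprn//; last by rewrite covE ltW.
  by rewrite covE.
clearbody L.
have Llow : 1 <= 2 * pi * expR 1 * L ^+ 2.
  have := expR_le_bound_det_covariance n0 fM cf mf f1 cmf D0.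
  rewrite mulrCA -LE -exprMn.
  have -> : expR (- (n%:R / 2)) = expR (- (1 / 2)) ^+ n :> R.
    by rewrite -expRM_natl; congr expR; field.
  rewrite ler_pXn2r ?nnegrE ?expR_ge0 ?mulr_ge0 ?(ltW s2pi)//.
  move=> h.
  have : expR (- (1 / 2)) ^+ 2 <= (Num.sqrt (2 * pi) * L) ^+ 2 :> R.
    by rewrite ler_sqr ?nnegrE ?expR_ge0 ?mulr_ge0 ?(ltW s2pi).
  rewrite exprMn sqr_sqrtr ?mulr_ge0 ?pi_ge0// -expRM_natl.
  have -> : 2%:R * - (1 / 2) = - 1 :> R by field.
  move=> h2; have := ler_wpM2l (expR_ge0 1) h2.
  rewrite -expRD subrr expR0 => h3; apply: le_trans h3 _.
  by rewrite le_eqVlt; apply/orP; left; apply/eqP; ring.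
pose m := (Num.truncn (K * L ^+ 2)).+1.
have KL0 : 0 <= K * L ^+ 2 by rewrite mulr_ge0 ?(ltW K0)// sqr_ge0.
have /andP[m1 m2] := truncn_itv KL0.
have m0 : (0 < m)%N by [].
have mR0 : 0 < m%:R :> R by rewrite ltr0n.
have mC : m%:R <= C * L ^+ 2.
  by rewrite /m -natr1 /C mulrDl lerD.
apply: (@le_trans _ _ (expR (- (n%:R / m%:R)))%:E).
  apply: (integral_depth_le n0 m0 f0 cf mf f1 cmf gM mg g1 D0).
  set D := Num.sqrt (\det (Defs.covariance f)) in LE *.
  have sm0 : 0 < Num.sqrt m%:R :> R by rewrite sqrtr_gt0.
  pose q := B * (L * (Num.sqrt m%:R / m%:R)).
  have q0 : 0 <= q by rewrite /q !mulr_ge0 ?invr_ge0 ?(ltW B0) ?(ltW mR0) ?(ltW sm0).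
  have q12 : 2 * q <= 1.
    have -> : 2 * q = 2 * B * L / Num.sqrt m%:R.
      rewrite /q -{2}(sqr_sqrtr (ltW mR0)); field; rewrite gt_eqF//.
    rewrite ler_pdivrMr// mul1r -(@ler_sqr _ (2 * B * L)) ?nnegrE ?mulr_ge0 ?(ltW B0) ?(ltW sm0)//.
    rewrite sqr_sqrtr ?(ltW mR0)//; apply: le_trans (ltW m2).
    by rewrite /K le_eqVlt; apply/orP; left; apply/eqP; ring.
  have -> : expR n%:R * M * (2 ^+ n.+1 / expR (- (n%:R / 2)) *
    ((2 / m%:R) ^+ n * (Num.sqrt (2 * pi) ^+ n * (Num.sqrt m%:R ^+ n * D)))) =
    2 * q ^+ n.
    have -> : expR (- (n%:R / 2)) = (expR (1 / 2) ^+ n)^-1 :> R.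
      by rewrite -expRM_natl -expRN; congr expR; field.
    have -> : expR n%:R = expR 1 ^+ n :> R by rewrite -expRM_natl mulr1.
    rewrite /q /B !exprMn LE invrK exprS.
    by ring.
  apply: le_trans (_ : (2 * q) ^+ n <= 1); last first.
    by rewrite exprn_ile1// mulr_ge0.
  (* The odd factor 2 of [2^(n+1)] is absorbed by [2 <= 2^n], which uses [n >= 1]. *)
  rewrite (exprMn n 2 q) ler_wpM2r ?exprn_ge0//.
  by rewrite -{1}[2]expr1 ler_weXn2l// ler1n.
have L20 : 0 < L ^+ 2 by rewrite exprn_gt0.
rewrite lee_fin ler_expR mulNr lerN2 -mulrA mulrCA ler_wpM2l//.
by rewrite -invfM lef_pV2 ?posrE ?mulr_gt0.
Qed.
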